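(* Let $k\ge 0$ be an integer and let $\chi$ be a signed permutation matrix (possibly empty). Let $\alpha_k$ and $\beta_k$ denote the $k\times k$ diagonal and antidiagonal permutation matrices, corresponding to $12\ldots k$ and $k(k-1)\ldots 1$, respectively. Then $$\begin{pmatrix}0&0&0&\alpha_k\\0&0&\chi&0\\0&\chi^t&0&0\\\alpha_k&0&0&0\end{pmatrix}\stackrel{I}{\sim}\begin{pmatrix}0&0&0&\beta_k\\0&0&\chi&0\\0&\chi^t&0&0\\\beta_k&0&0&0\end{pmatrix}$$ and $$\begin{pmatrix}0&0&0&0&\alpha_k\\0&0&0&\chi&0\\0&0&1&0&0\\0&\chi^t&0&0&0\\\alpha_k&0&0&0&0\end{pmatrix}\stackrel{I}{\sim}\begin{pmatrix}0&0&0&0&\beta_k\\0&0&0&\chi&0\\0&0&1&0&0\\0&\chi^t&0&0&0\\\beta_k&0&0&0&0\end{pmatrix},$$ where $\chi^t$ is the transpose of $\chi$, the central $1$ is a $1\times1$ block, and $\stackrel{I}{\sim}$ denotes I-Wilf equivalence.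
   Context: A signed permutation matrix of size $n$ is an $n\times n$ matrix with entries in $\{0,1,-1\}$ having exactly one nonzero entry in every row and every column; $B_n$ is the set of these. A matrix $p\in B_n$ corresponds to the word $\pi=\pi_1\cdots\pi_n$ with $\pi_i=j$ if $p_{ij}=1$ and $\pi_i=-j$ if $p_{ij}=-1$. $SI_n$ is the set of involutions in $B_n$, i.e. the symmetric signed permutation matrices of size $n$. An element $\pi\in B_n$ contains a signed permutation matrix $\tau$ if $\tau$ is a submatrix of $\pi$ (rows and columns kept in order); otherwise $\pi$ avoids $\tau$. $SI_n(\tau)$ is the set of elements of $SI_n$ avoiding $\tau$. Two signed patterns $\sigma,\tau$ are I-Wilf equivalent, $\sigma\stackrel{I}{\sim}\tau$, if $|SI_n(\sigma)|=|SI_n(\tau)|$ for every $n\ge1$. *)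

(* Defs.v *)
From HB Require Import structures.
From mathcomp Require Import all_boot all_order all_algebra.

Set Implicit Arguments.
Unset Strict Implicit.
Unset Printing Implicit Defensive.

Import GRing.Theory.
Local Open Scope ring_scope.

Definition signed_perm_mx n (p : 'M[int]_n) : bool :=
  [&& [forall i, forall j, p i j \in [:: 0; 1; -1]],
      [forall i, #|[set j | p i j != 0]| == 1%N] &
      [forall j, #|[set i | p i j != 0]| == 1%N]].

Record B n := SignedPerm {
  mx_of_B :> 'M[int]_n;
  mx_of_BP : signed_perm_mx mx_of_B }.

HB.instance Definition _ n := [isSub for @mx_of_B n].
HB.instance Definition _ n := [Choice of B n by <:].

(* B n is finite: it embeds into the n x n matrices over the three-element
   type 'I_3, through the index of each entry in [:: 0; 1; -1]. *)
Definition B_encode n (p : B n) : 'M['I_3]_n :=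
  \matrix_(i, j) inord (index (p i j) [:: 0; 1; -1]).

Definition B_decode n (q : 'M['I_3]_n) : option (B n) :=
  insub (\matrix_(i, j) nth 0 [:: 0; 1; -1] (q i j)).

Lemma B_encodeK n : pcancel (@B_encode n) (@B_decode n).
Proof.
move=> p; rewrite /B_decode.
suff -> : \matrix_(i, j) nth 0 [:: 0; 1; -1] (B_encode p i j) = val p.
  exact: valK.
apply/matrixP=> i j; rewrite !mxE.
have /and3P[/forallP/(_ i)/forallP/(_ j) pij _ _] := mx_of_BP p.
have lt3 : (index (p i j) [:: 0; 1; -1]%R < 3)%N by rewrite -index_mem in pij; exact: pij.
by rewrite inordK // nth_index.
Qed.

HB.instance Definition _ n : isCountable (B n) := PCanIsCountable (@B_encodeK n).
HB.instance Definition _ n : isFinite (B n) := PCanIsFinite (@B_encodeK n).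

Definition SI n : {set B n} := [set p : B n | (p : 'M_n) *m p == 1%:M].

Lemma signed_perm_mulmx_tr n (p : B n) : (p : 'M_n) *m p^T = 1%:M.
Proof.
have /and3P[/forallP pE /forallP pr /forallP pc] := mx_of_BP p.
apply/matrixP=> i i'; rewrite !mxE.
have /cards1P[j Ej] := pr i.
have nz j' : (p i j' != 0) = (j' == j).
  by move/setP/(_ j'): Ej; rewrite !inE.
rewrite (bigD1 j) //= big1 ?addr0; last first.
  by move=> j' /negPf j'j; move: (nz j'); rewrite j'j => /negbFE/eqP->; rewrite mul0r.
rewrite mxE; have [<-|ii'] := eqVneq i i'.
  have := nz j; rewrite eqxx; have /forallP/(_ j) := pE i.
  by rewrite !inE => /or3P[] /eqP->.
have /cards1P[i0 Ei] := pc j.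
have := nz j; rewrite eqxx => pij.
have ei : i = i0 by apply/eqP; move/setP/(_ i): Ei; rewrite !inE pij => <-.
move/setP/(_ i'): Ei; rewrite !inE -ei [i' == i]eq_sym (negPf ii') => /negbFE/eqP->.
by rewrite mulr0.
Qed.

Lemma SI_sym n (p : B n) : (p \in SI n) = ((p : 'M_n)^T == p).
Proof.
rewrite inE; apply/eqP/eqP => [pp|{2}<-]; last exact: signed_perm_mulmx_tr.
by rewrite -[LHS]mul1mx -pp -mulmxA signed_perm_mulmx_tr mulmx1.
Qed.

Definition increasing k n (f : {ffun 'I_k -> 'I_n}) : bool :=
  [forall i : 'I_k, forall j : 'I_k, (i < j)%N ==> (f i < f j)%N].

Definition contains n k (p : 'M[int]_n) (tau : 'M[int]_k) : bool :=
  [exists f : {ffun 'I_k -> 'I_n}, exists g : {ffun 'I_k -> 'I_n},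
    [&& increasing f, increasing g & mxsub f g p == tau]].

Definition SI_avoid n k (tau : 'M[int]_k) : {set B n} :=
  [set p in SI n | ~~ contains p tau].

Definition I_Wilf k l (sigma : 'M[int]_k) (tau : 'M[int]_l) : Prop :=
  forall n, (1 <= n)%N -> #|SI_avoid n sigma| = #|SI_avoid n tau|.

Definition alpha k : 'M[int]_k := 1%:M.
Definition beta k : 'M[int]_k := \matrix_(i, j) (j == rev_ord i)%:R.

Definition even_pattern k m (a : 'M[int]_k) (chi : 'M[int]_m)
    : 'M[int]_(k + (m + (m + k))) :=
  col_mx         (row_mx 0 (row_mx 0     (row_mx 0   a)))
  (col_mx        (row_mx 0 (row_mx 0     (row_mx chi 0)))
  (col_mx        (row_mx 0 (row_mx chi^T (row_mx 0   0)))
                 (row_mx a (row_mx 0     (row_mx 0   0))))).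

Definition odd_pattern k m (a : 'M[int]_k) (chi : 'M[int]_m)
    : 'M[int]_(k + (m + (1 + (m + k)))) :=
  col_mx         (row_mx 0 (row_mx 0     (row_mx 0    (row_mx 0   a))))
  (col_mx        (row_mx 0 (row_mx 0     (row_mx 0    (row_mx chi 0))))
  (col_mx        (row_mx 0 (row_mx 0     (row_mx 1%:M (row_mx 0   0))))
  (col_mx        (row_mx 0 (row_mx chi^T (row_mx 0    (row_mx 0   0))))
                 (row_mx a (row_mx 0     (row_mx 0    (row_mx 0   0))))))).

(* Main.v *)
Require Import Defs.
From mathcomp Require Import all_boot all_order all_algebra.
From mathcomp Require Import zify.
Set Implicit Arguments.
Unset Strict Implicit.
Unset Printing Implicit Defensive.

(** Why the theorem is true.

    Write [p] for a signed involution, i.e. a symmetric signed permutation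
    matrix.  Such a [p] contains one of the two patterns iff some copy of the
    block pair (the k x k block [a] in the upper right, [chi] below and to the
    left of it, and, for the odd pattern, a 1 weakly above the diagonal in the
    middle) occurs with all its rows before all its columns: the other half of
    the pattern is the mirror image, and if an occurrence is not of this kind
    then its transpose is ([contains_region], [region_contains]).  So colour
    the cells (i, j) above the diagonal that have a copy of [chi] (and of the
    central 1) strictly between i and j.  The coloured cells form a Ferrers
    board with corner at the upper right, and [p] contains the pattern iff the
    entries 1 of [p] in the coloured [region] contain [a], the whole
    rectangle spanned by that occurrence being coloured.

    Rearranging the coloured entries 1 within their rows and columns (and
    doing the mirror operation below the diagonal) does not change the colours,
    because every coloured cell has a witness made of uncoloured entries only
    ([region_stable]).  Signed involutions therefore split into classes, each of
    which is in bijection with all the fillings of one Ferrers board by a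
    partial permutation with prescribed sets of rows and columns
    ([graft_class], [card_class]).  What remains is the theorem of Backelin,
    West and Xin: as many fillings of a Ferrers board avoid the identity
    pattern as avoid the antidiagonal one ([card_fillings_ltn_gtn]).

    That theorem is proved with growth diagrams.  Read the columns of the board
    from the longest to the shortest, row-inserting the row index of the entry
    of each column into a tableau, and delete a letter from the tableau when
    its row ends; deleted letters are always the largest ones present.  The
    insertion step is reversible once the new shape is known ([insertK],
    [extractP]), so the number of fillings whose tableaux all have shapes in a
    given class is the number of sequences of diagrams in that class along the
    boundary of the board ([sum_words_at]).  Transposing all the diagrams of a
    sequence exchanges the condition that rows are short and the condition that
    there are few rows ([shape_paths_transp]).  By Schensted's theorem these say
    that the filling avoids increasing, respectively decreasing, chains
    ([rowlen0_rsk], [rowlen_gt0_rsk]).  The second half of Schensted's theorem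
    is obtained by Viennot's method: the letters bumped out of the first row
    form a word, the [skeleton], whose longest decreasing subsequence is shorter
    by one ([lds_skeleton]). *)

(** * Tableaux and row insertion *)

Lemma SomeE (a b : nat) : (Some a == Some b) = (a == b).
Proof. by []. Qed.

(** A standard tableau with letters below n is stored as the list of the rows
    that contain n - 1, ..., 1, 0 (in this order, [None] for an absent letter).
    With the largest letter first, removing the largest letter is [behead], and
    row insertion is a structural recursion that handles the small letters
    first. *)
Definition tableau := seq (option nat).
Definition rowlen (r : nat) (s : tableau) : nat := count_mem (Some r) s.
Arguments rowlen : simpl never.
Definition addable (r : nat) (s : tableau) : bool :=
  (r == 0) || (rowlen r s < rowlen r.-1 s).
Definition removable (r : nat) (s : tableau) : bool := rowlen r.+1 s < rowlen r s.

(** The lattice word condition: each letter sits in a corner of the shape formed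
    by it and the smaller ones.  It replaces the monotonicity of rows and columns. *)
Fixpoint is_tableau (s : tableau) : bool :=
  if s is a :: s' then (if a is Some r then addable r s' else true) && is_tableau s'
  else true.
Definition row_of (s : tableau) (v : nat) : option nat := nth None (rev s) v.
Arguments row_of : simpl never.
Arguments addable : simpl never.
Arguments removable : simpl never.

(** Row insertion of [v], returning also the row in which the shape grows.  All
    the bumps are done in one scan of the letters in increasing order that
    carries the row t of the box gained so far: a letter of row t is the one
    that is bumped, to row t + 1. *)
Fixpoint insert (v : nat) (s : tableau) : nat * tableau :=
  if s is a :: s' then
    if v == size s' then (0, Some 0 :: s')
    else let: (t, s1) := insert v s' in
         if a == Some t then (t.+1, Some t.+1 :: s1) else (t, a :: s1)
  else (0, [::]).

(** Inverse of [insert]: pulls back the corner of row [r], scanning the letters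
    downwards, and returns the expelled letter.  A letter met in the current row
    r > 0 moves up to row r - 1; met in row 0 it is the expelled one. *)
Fixpoint extract (r : nat) (s : tableau) : nat * tableau :=
  if s is a :: s' then
    if a == Some r then
      if r is r'.+1 then let: (v, s1) := extract r' s' in (v, Some r' :: s1)
      else (size s', None :: s')
    else let: (v, s1) := extract r s' in (v, a :: s1)
  else (0, [::]).

Lemma row_of_cons a s v :
  row_of (a :: s) v = if v == size s then a else row_of s v.
Proof.
rewrite /row_of rev_cons nth_rcons size_rev.
case: ltngtP => // h; by rewrite nth_default // size_rev ltnW.
Qed.

Lemma row_of_default s v : size s <= v -> row_of s v = None.
Proof. by move=> h; rewrite /row_of nth_default // size_rev. Qed.

Lemma size_insert v s : size (insert v s).2 = size s.
Proof.
elim: s => //= a s IH; case: ifP => // _.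
by case: (insert v s) IH => t s1 /= IH; case: ifP => /= _; rewrite IH.
Qed.

Lemma size_extract r s : size (extract r s).2 = size s.
Proof.
elim: s r => //= a s IH r; case: ifP => // _; last first.
  by have := IH r; case: (extract r s) => ? ? /= ->.
by case: r => // r; have := IH r; case: (extract r s) => ? ? /= ->.
Qed.

Lemma rowlen_cons r a s : rowlen r (a :: s) = (a == Some r) + rowlen r s.
Proof. by []. Qed.

Lemma rowlen_insert v s r : v < size s -> row_of s v = None ->
  rowlen r (insert v s).2 = (r == (insert v s).1) + rowlen r s.
Proof.
elim: s => //= a s IH; rewrite row_of_cons ltnS => le; case: (eqVneq v (size s)) => [ev an|ne en] /=.
  by rewrite !rowlen_cons an /= eq_sym.
have {}/IH : v < size s by lia.
move/(_ en); case: (insert v s) => t s1 /= H.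
case: eqP => [->|nt] /=; rewrite !rowlen_cons H; last by lia.
rewrite ?SomeE.
by lia.
Qed.

Lemma tableau_rowlen s r : is_tableau s -> rowlen r.+1 s <= rowlen r s.
Proof.
elim: s => //= a s IH /andP[h /IH]; rewrite !rowlen_cons.
case: a h => [q|_] /=; last by lia.
rewrite /addable ?SomeE => h H.
case: (eqVneq q r.+1) h => [->|]; rewrite /=; lia.
Qed.

(** The shape grows by a corner because, when a letter of row t is bumped, the
    shape of the letters scanned so far has just gained a box in row t, which
    makes room below it in row t + 1. *)
Lemma insert_tableau v s : v < size s -> row_of s v = None -> is_tableau s ->
  is_tableau (insert v s).2 && addable (insert v s).1 s.
Proof.
elim: s => //= a s IH; rewrite row_of_cons ltnS => le /[swap] /andP[ha hs].
case: (eqVneq v (size s)) => [ev an|ne en] /=; first by rewrite hs.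
have lv : v < size s by lia.
have /andP[] := IH lv en hs.
have := rowlen_insert _ lv en; case: (insert v s) => t s1 /= H v1 at_.
case: eqP => [ea|nt] /=.
  rewrite v1 andbT /addable /= !H !rowlen_cons ea ?SomeE !eqxx.
  by have := tableau_rowlen t hs; lia.
rewrite v1 andbT; case: a ha nt => [q|] /= ha nt; last first.
  by move: at_; rewrite /addable !rowlen_cons /=.
have nqt : q <> t by move=> e; apply: nt; rewrite e.
move: at_ ha; rewrite /addable !H !rowlen_cons ?SomeE.
have := tableau_rowlen t.-1 hs; have := tableau_rowlen q.-1 hs.
case: q nqt {nt} => [|q]; case: t H => [|t] H //= nqt; try lia.
all: lia.
Qed.

Lemma insertK v s : v < size s -> row_of s v = None ->
  extract (insert v s).1 (insert v s).2 = (v, s).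
Proof.
elim: s => //= a s IH; rewrite row_of_cons ltnS => le.
case: (eqVneq v (size s)) => [-> -> //|ne en] /=.
have lv : v < size s by lia.
move: (IH lv en); case: (insert v s) => t s1 /= H.
case: eqP => [->|nt] /=; first by rewrite eqxx H.
by case: eqP => // _; rewrite H.
Qed.

(** Pulling back a corner always ends by expelling a letter: if the row to be
    emptied is r at some stage, it is still removable in the tableau of the
    remaining smaller letters, so the scan cannot reach the empty tableau. *)
Lemma extractP r s : is_tableau s -> removable r s ->
  [/\ (extract r s).1 < size s, row_of (extract r s).2 (extract r s).1 = None,
      insert (extract r s).1 (extract r s).2 = (r, s),
      is_tableau (extract r s).2 & forall q, rowlen q s = (q == r) + rowlen q (extract r s).2].
Proof.
elim: s r => [|a s IH] r; first by rewrite /removable.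
rewrite /removable !rowlen_cons /= => /andP[ha hs].
case: (a =P Some r) ha => [->|na] ha /=.
  rewrite ?SomeE ?eqxx => h.
  case: r ha h => [|r] /= ha h.
    rewrite row_of_cons !eqxx; split=> // q.
    by rewrite !rowlen_cons ?SomeE eq_sym.
  have hr : removable r s by move: ha; rewrite /addable /removable /=.
  have [] := IH r hs hr; have := size_extract r s; case: (extract r s) => v s1 /= ss lv en iK v1 H.
  rewrite row_of_cons ss; have -> : (v == size s) = false by lia.
  rewrite iK eqxx v1 andbT; split => //; first by lia.
    have := H r; rewrite eqxx => Hr; rewrite /addable.
    case: r hr ha h iK H Hr => [//|r] hr ha h iK H Hr /=.
    have := H r; have := tableau_rowlen r hs; move: hr; rewrite /removable.
    by rewrite Hr; have := H r.+2; lia.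
  move=> q; rewrite !rowlen_cons H ?SomeE.
  by lia.
move=> h.
have hr : removable r s.
  by rewrite /removable; move: h; lia.
have [] := IH r hs hr; have := size_extract r s; case: (extract r s) => v s1 /= ss lv en iK v1 H.
rewrite row_of_cons ss; have -> : (v == size s) = false by lia.
rewrite iK; case: eqP => // _; rewrite v1 andbT; split => //; first by lia.
  case: a ha na h => [q|] //= ha na h.
  have nq : q <> r by move=> e; apply: na; rewrite e.
  move: ha; rewrite /addable; have := H q; have := H q.-1.
  move: h; rewrite ?SomeE.
  case: q {na} nq => [//|q] nq /=.
  case: (eqVneq q r) => [->|]; lia.
by move=> q; rewrite !rowlen_cons H; lia.
Qed.

Lemma rowlen_gt0_size r s : is_tableau s -> 0 < rowlen r s -> r < size s.
Proof.
elim: s r => //= a s IH r /andP[ha hs]; rewrite rowlen_cons.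
case: eqP => [ea _|_ /=]; last by move/(IH _ hs); lia.
move: ha; rewrite ea /addable; case: r ea => //= r ea h.
by have := IH r hs; lia.
Qed.

(** * Insertion of words, and the first row *)

Lemma row_of_insert v s u : v < size s -> row_of s v = None ->
  (row_of (insert v s).2 u == None) = (row_of s u == None) && (u != v).
Proof.
elim: s => //= a s IH; rewrite row_of_cons ltnS => le.
case: (eqVneq v (size s)) => [-> an|ne en] /=.
  by rewrite !row_of_cons; case: (u =P size s); rewrite ?andbF ?andbT.
have lv : v < size s by lia.
have := IH lv en; have := size_insert v s; case: (insert v s) => t s1 /= ss H.
case: (a =P Some t) => [ea|_] /=; rewrite !row_of_cons ss; case: (u =P size s) => // ->.
  by rewrite ea.
by rewrite [size s == v]eq_sym ne andbT.
Qed.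

Lemma drop_insert j v s : v < size s -> j <= size s ->
  drop j (insert v s).2 = if v < size s - j then (insert v (drop j s)).2 else drop j s.
Proof.
elim: j s => [|j IH] [|a s] //=; first by rewrite drop0 subn0 => ->.
rewrite !ltnS subSS => lv lj; case: eqP => [->|ne] /=.
  by case: ifP => //; lia.
have := IH s; case: (insert v s) => t s1 /= H.
by case: ifP => _ /=; rewrite H //; lia.
Qed.

(** Words are stored with the letter inserted last in front, so that [foldr]
    inserts the letters in reading order; increasing subsequences of the reading
    order are therefore decreasing sublists, and conversely. *)
Definition rsk n (w : seq nat) : tableau := foldr (fun v s => (insert v s).2) (nseq n None) w.

Definition inj_word n (w : seq nat) := uniq w && all (ltn^~ n) w.

Lemma inj_word_cons n v w : inj_word n (v :: w) = [&& v < n, v \notin w & inj_word n w].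
Proof. by rewrite /inj_word /=; case: (v \in w); case: (v < n); case: uniq; rewrite ?andbF. Qed.

Lemma size_rsk n w : size (rsk n w) = n.
Proof. by elim: w => [|v w IH] /=; rewrite ?size_nseq // size_insert. Qed.

Lemma row_of_rsk n w u : inj_word n w -> (row_of (rsk n w) u == None) = (u \notin w).
Proof.
elim: w u => [|v w IH] u /=; first by rewrite /row_of rev_nseq nth_nseq if_same.
rewrite inj_word_cons => /and3P[lv vw ww].
rewrite row_of_insert ?size_rsk ?IH //; last by apply/eqP; rewrite IH.
by rewrite inE negb_or andbC.
Qed.

Lemma row_of_rsk_None n w v : inj_word n w -> v \notin w -> row_of (rsk n w) v = None.
Proof. by move=> ww vw; apply/eqP; rewrite row_of_rsk. Qed.

Lemma rsk_tableau n w : inj_word n w -> is_tableau (rsk n w).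
Proof.
elim: w => [|v w IH]; first by move=> _; elim: n.
rewrite inj_word_cons => /and3P[lv vw ww] /=.
have en := row_of_rsk_None ww vw.
by have /andP[] := insert_tableau (etrans (congr1 _ (size_rsk n w)) lv) en (IH ww).
Qed.

Lemma inj_word_filter n y w : inj_word n w -> inj_word y (filter (ltn^~ y) w).
Proof. by case/andP=> uw _; rewrite /inj_word filter_uniq //= filter_all. Qed.

(** Large letters never influence small ones: restricting the tableau to the
    letters below [y] amounts to inserting only these letters. *)
Lemma drop_rsk n y w : inj_word n w -> y <= n ->
  drop (n - y) (rsk n w) = rsk y (filter (ltn^~ y) w).
Proof.
move=> + le; elim: w => [_|v w IH] /=; first by rewrite drop_nseq subKn.
rewrite inj_word_cons => /and3P[lv vw ww].
rewrite drop_insert ?size_rsk ?leq_subr // subKn // IH //.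
by case: ifP.
Qed.

(** Longest increasing subsequence (in reading order) with all letters below
    [y], and longest decreasing one with all letters at least [u]; the moving
    bound is what the recursion on the last letter read needs. *)
Fixpoint lis (w : seq nat) y :=
  if w is v :: w' then if v < y then maxn (lis w' y) (lis w' v).+1 else lis w' y
  else 0.

Fixpoint lds (w : seq nat) u :=
  if w is v :: w' then if u <= v then maxn (lds w' u) (lds w' v.+1).+1 else lds w' u
  else 0.

(** The local rule of growth diagrams for the first row: the recursion that
    defines [lis]. *)
Lemma rowlen0_insert v s : v < size s -> row_of s v = None ->
  rowlen 0 (insert v s).2 = maxn (rowlen 0 s) (rowlen 0 (drop (size s - v) s)).+1.
Proof.
elim: s => //= a s IH; rewrite row_of_cons ltnS => le.
case: (eqVneq v (size s)) => [-> ->|ne en] /=.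
  by rewrite subSnn /= drop0 !rowlen_cons /=; lia.
have lv : v < size s by lia.
have -> : (size s).+1 - v = (size s - v).+1 by lia.
move: (IH lv en); rewrite (rowlen_insert 0 lv en) /=.
have := rowlen_insert 0 lv en; case: (insert v s) => t s1 /= H.
case: (a =P Some t) => [->|na] /=; rewrite !rowlen_cons H ?SomeE; first by lia.
by case: (0 =P t) na => [<- /eqP/negPf->|_ _]; lia.
Qed.

Lemma rowlen0_rsk n w y : inj_word n w -> y <= n ->
  rowlen 0 (rsk y (filter (ltn^~ y) w)) = lis w y.
Proof.
elim: w y => [|v w IH] y; first by move=> _ _; elim: y.
rewrite inj_word_cons => /and3P[lv vw ww] le /=.
have wy := inj_word_filter y ww.
case: ifP => vy; last exact: IH.
rewrite /= rowlen0_insert ?size_rsk //; last first.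
  by apply: row_of_rsk_None => //; rewrite mem_filter (negPf vw) andbF.
rewrite IH // drop_rsk //; last exact: ltnW.
rewrite -filter_predI (eq_filter (a2 := ltn^~ v)) ?IH ?(ltnW lv) // => x /=.
by case: (ltnP x v) => //= xv; rewrite (ltn_trans xv).
Qed.

(** * The skeleton of a word, and the number of rows *)

(** The least element of [R] that is at least [u]; [leastP] is its
    specification. *)
Fixpoint least (R : seq nat) u : option nat :=
  if R is x :: R' then
    if u <= x then Some (if least R' u is Some z then minn x z else x) else least R' u
  else None.

Lemma leastP R u :
  if least R u is Some z then [/\ z \in R, u <= z & forall x, x \in R -> u <= x -> z <= x]
  else forall x, x \in R -> x < u.
Proof.
elim: R => //= a R; case: ifP => ua; case: least => [z|].
- case=> zR uz H; split.
  + by rewrite inE; case: leqP => _; rewrite ?eqxx // zR orbT.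
  + by rewrite leq_min ua.
  by move=> x; rewrite inE geq_min => /predU1P[->|xR] ux; rewrite ?leqnn // H ?orbT.
- move=> H; split; rewrite ?inE ?eqxx // => x; rewrite inE => /predU1P[->|] // /H.
  by move=> h1 h2; lia.
- case=> zR uz H; split; rewrite ?inE ?zR ?orbT // => x; rewrite inE => /predU1P[->|].
    by rewrite ua.
  exact: H.
by move=> H x; rewrite inE => /predU1P[->|/H //]; lia.
Qed.

Lemma least_eq R u z : z \in R -> u <= z -> (forall x, x \in R -> u <= x -> z <= x) ->
  least R u = Some z.
Proof.
move=> zR uz H; have := leastP R u; case: least => [y [yR uy Hy]|/(_ z zR)]; last by lia.
by congr Some; apply/eqP; rewrite eqn_leq Hy // H.
Qed.

Lemma least_none R u : (forall x, x \in R -> x < u) -> least R u = None.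
Proof.
by move=> H; have := leastP R u; case: least => // y [/H]; lia.
Qed.

(** The set of letters in the first row after inserting [w], in no particular
    order: the new letter replaces the next larger one. *)
Fixpoint first_row (w : seq nat) : seq nat :=
  if w is v :: w' then
    v :: (if least (first_row w') v is Some y then filter (predC1 y) (first_row w') else first_row w')
  else [::].

(** The word of the letters bumped out of the first row, i.e. the word that is
    inserted into the rows below it. *)
Fixpoint skeleton (w : seq nat) : seq nat :=
  if w is v :: w' then
    (if least (first_row w') v is Some y then y :: skeleton w' else skeleton w')
  else [::].

Lemma sub_first_row w : {subset first_row w <= w}.
Proof.
elim: w => //= v w IH x; rewrite !inE; case: (x =P v) => //= _.
case: least => [y|/IH //]; by rewrite mem_filter => /andP[_ /IH].
Qed.

Lemma lds_mono w u u' : u <= u' -> lds w u' <= lds w u.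
Proof.
elim: w u u' => //= v w IH u u' h; have := IH _ _ h.
by case: (leqP u v); case: (leqP u' v); lia.
Qed.

Lemma least_ext R R' u u' :
  (forall x, (x \in R) && (u <= x) = (x \in R') && (u' <= x)) -> least R u = least R' u'.
Proof.
move=> H; have := leastP R' u'; case: least => [z [zR uz Hz]|Hn].
  have /andP[zR' uz'] : (z \in R) && (u <= z) by rewrite H zR uz.
  apply: least_eq => // x xR ux; have /andP[] : (x \in R') && (u' <= x) by rewrite -H xR ux.
  exact: Hz.
apply: least_none => x xR; rewrite ltnNge; apply/negP=> ux.
by have := H x; rewrite xR ux => /esym/andP[/Hn]; lia.
Qed.

(** Viennot's comparison of decreasing subsequences of a word and of its
    skeleton, in a form that is stable under adding a letter.  Let [u] be a letter
    that does not occur in [w] and z the next letter of the first row.  Inserting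
    [u] would bump z, so the right-hand side is the longest decreasing
    subsequence above [u] in the skeleton of the word extended by [u]; the
    left-hand side is one less than the longest decreasing subsequence of the
    extended word that ends at [u]. *)
Lemma lds_skeleton w u : uniq w ->
  lds w u = maxn (lds (skeleton w) u)
              (if least (first_row w) u is Some z then (lds (skeleton w) z.+1).+1 else 0).
Proof.
elim: w u => [//|v w IH] u /= /andP[vw uw].
have vR : v \notin first_row w by apply: contra vw; apply: sub_first_row.
have nv x : x \in first_row w -> x != v by move=> xR; apply: contraNneq vR => <-.
have -> : lds w v.+1 = maxn (lds (skeleton w) v.+1)
    (if least (first_row w) v is Some z then (lds (skeleton w) z.+1).+1 else 0).
  rewrite IH //; congr (maxn _ _); rewrite (@least_ext _ (first_row w) v.+1 v) // => x.
  by case xR : (x \in first_row w) => //=; have := nv _ xR; lia.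
rewrite IH //; have := leastP (first_row w) v; case Ey : (least (first_row w) v) => [y|].
  (* the new letter v bumps y *)
  case=> yR vy Hy; have yv := nv _ yR; rewrite /=; case: (leqP u v) => uv.
    have -> : u <= y by lia.
    have := leastP (first_row w) u; case: (least (first_row w) u) => [z|/(_ y yR)]; last by lia.
    case=> zR uz Hz; have zv := nv _ zR.
    have zy := Hz _ yR (leq_trans uv vy).
    case: (ltnP z v) => lzv.
      have -> : least (filter (predC1 y) (first_row w)) u = Some z.
        apply: least_eq => [|//|x]; first by rewrite mem_filter zR andbT /=; lia.
        by rewrite mem_filter => /andP[_ xR]; apply: Hz.
      have -> : minn v z = z by lia.
      have -> : z < y by lia.
      have := @lds_mono (skeleton w) z.+1 v.+1; lia.
    (* no letter of the row lies between u and v, which becomes the next one *)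
    have ezy : z = y by have := Hy _ zR lzv; lia.
    rewrite ezy in Hz * => {z zR uz zv zy lzv ezy}.
    have -> : (if least (filter (predC1 y) (first_row w)) u is Some z then minn v z else v) = v.
      have := leastP (filter (predC1 y) (first_row w)) u.
      case: least => // z [+ uz _]; rewrite mem_filter => /andP[_ zR].
      have := Hz _ zR uz; lia.
    have -> : v < y by lia.
    lia.
  case: (leqP u y) => uy.
    (* y, the next letter above u, moves from the row to the skeleton *)
    have -> : least (first_row w) u = Some y.
      by apply: least_eq => // x xR ux; apply: Hy => //; lia.
    have -> : least (filter (predC1 y) (first_row w)) u = least (first_row w) y.+1.
      apply: least_ext => x; rewrite mem_filter /=; case xR: (x \in first_row w); rewrite ?andbF //=.
      by rewrite andbT; have := Hy x xR; have := nv _ xR; lia.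
    have := leastP (first_row w) y.+1; case: least => [z [_ yz _]|]; last by lia.
    have := @lds_mono (skeleton w) y.+1 z.+1; case: ifP; lia.
  have -> : least (filter (predC1 y) (first_row w)) u = least (first_row w) u.
    by apply: least_ext => x; rewrite mem_filter /=; case: (x \in first_row w); rewrite ?andbF //=; lia.
  have := leastP (first_row w) u; case: least => [z [_ uz _]|//].
  by have -> : (z < y) = false by lia.
(* v is appended at the end of the row *)
move=> Hv /=; case: (leqP u v) => uv //.
have := leastP (first_row w) u; case: (least (first_row w) u) => [z [zR uz _]|_]; last by lia.
have zv := Hv _ zR; have -> : minn v z = z by lia.
have := @lds_mono (skeleton w) z.+1 v.+1; lia.
Qed.

Definition strip_row (s : tableau) : tableau := map (fun a => if a is Some r.+1 then Some r else None) s.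

Fixpoint first_row_letters (s : tableau) : seq nat :=
  if s is a :: s' then if a == Some 0 then size s' :: first_row_letters s' else first_row_letters s' else [::].

Lemma size_strip_row s : size (strip_row s) = size s.
Proof. exact: size_map. Qed.

Lemma rowlen_strip_row r s : rowlen r (strip_row s) = rowlen r.+1 s.
Proof.
elim: s => //= a s IH; rewrite !rowlen_cons IH; congr (_ + _).
by case: a => [[|q]|].
Qed.

Lemma first_row_letters_lt s u : u \in first_row_letters s -> u < size s.
Proof.
elim: s => //= a s IH; case: ifP => _; rewrite ?inE; last by move/IH/ltnW.
by case/predU1P => [->//|/IH/ltnW].
Qed.

Lemma row_of_first_row s u : u \in first_row_letters s -> row_of s u = Some 0.
Proof.
elim: s => //= a s IH; rewrite row_of_cons; case: (a =P Some 0) => [->|_].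
  by rewrite inE; case: (u =P size s) => //= _; apply: IH.
move=> us; have -> : (u == size s) = false by have := first_row_letters_lt us; lia.
exact: IH.
Qed.

Lemma row_of_strip_row s u : row_of s u = Some 0 -> row_of (strip_row s) u = None.
Proof.
elim: s => [|a s IH] /=; first by rewrite row_of_default.
by rewrite !row_of_cons size_strip_row; case: (u =P size s) => // _ ->.
Qed.

(** The rows below the first one form a tableau into which exactly the letters
    bumped from the first row are inserted. *)
Lemma insert_strip_row v s : v < size s -> row_of s v = None ->
  if least (first_row_letters s) v is Some y
  then (insert v s).1 = (insert y (strip_row s)).1.+1 /\ strip_row (insert v s).2 = (insert y (strip_row s)).2
  else (insert v s).1 = 0 /\ strip_row (insert v s).2 = strip_row s.
Proof.
elim: s => // a s IH; rewrite row_of_cons /= ltnS => le.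
case: (eqVneq v (size s)) => [ev ->|ne en] /=.
  rewrite least_none // => x /first_row_letters_lt; lia.
have lv : v < size s by lia.
have zle : least (first_row_letters (a :: s)) v =
    (if least (first_row_letters s) v is Some z then Some z else if a == Some 0 then Some (size s) else None).
  rewrite /=; case: ifP => _ /=; rewrite ?le; have := leastP (first_row_letters s) v; case: least => [z [zs _ _]|] //.
  by congr Some; have := first_row_letters_lt zs; lia.
rewrite -[X in least X]/(first_row_letters (a :: s)) zle.
have := leastP (first_row_letters s) v; have := IH lv en.
case: least => [y [H1 H2] [yz _ _]|[H1 H2] _] /=.
  have -> : (y == size (strip_row s)) = false by rewrite size_strip_row; have := first_row_letters_lt yz; lia.
  move: H1 H2; case: (insert v s) => t s1; case: (insert y (strip_row s)) => t' s1' /= -> <-.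
  case: a {zle} => [[|q]|] //=; rewrite !SomeE ?eqSS.
  by case: (q == t').
move: H1 H2; case: (insert v s) => t s1 /= -> H2.
case: eqP => [ea|na] /=; last by rewrite H2.
by rewrite size_strip_row eqxx /= H2.
Qed.

Lemma mem_first_row_insert v s u : v < size s -> row_of s v = None ->
  (u \in first_row_letters (insert v s).2) = (u == v) || (u \in first_row_letters s) && (least (first_row_letters s) v != Some u).
Proof.
elim: s => // a s IH; rewrite row_of_cons /= ltnS => le.
case: (eqVneq v (size s)) => [ev ->|ne en] /=.
  rewrite inE -ev least_none ?andbT // => x /first_row_letters_lt; lia.
have lv : v < size s by lia.
have zle : least (first_row_letters (a :: s)) v =
    (if least (first_row_letters s) v is Some z then Some z else if a == Some 0 then Some (size s) else None).
  rewrite /=; case: ifP => _ /=; rewrite ?le; have := leastP (first_row_letters s) v; case: least => [z [zs _ _]|] //.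
  by congr Some; have := first_row_letters_lt zs; lia.
rewrite -[X in least X]/(first_row_letters (a :: s)) zle.
have := leastP (first_row_letters s) v; have := IH lv en; have := insert_strip_row lv en; have := size_insert v s.
case: (insert v s) => t s1 /= ss.
case: least => [y [H1 _] H [yz _ _]|[H1 _] H _].
  rewrite H1; case: a zle => [[|q]|] //= _; last by case: ifP => _ /=; rewrite H.
  rewrite !inE H ss; case: (u =P size s) => //= ->.
  by rewrite ?SomeE; have := first_row_letters_lt yz; lia.
rewrite H1; case: a {zle} => [[|q]|] //=; rewrite H; try by rewrite andbT.
have /negPf nz : size s \notin first_row_letters s by apply/negP=> /first_row_letters_lt; lia.
rewrite inE !andbT SomeE; case: (u =P size s) => [->|/eqP nu]; first by rewrite nz eqxx.
by rewrite [size s == u]eq_sym nu andbT.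
Qed.

Lemma rsk_skeleton n w : inj_word n w ->
  [/\ inj_word n (skeleton w), strip_row (rsk n w) = rsk n (skeleton w) & first_row_letters (rsk n w) =i first_row w].
Proof.
elim: w => [_|v w IH].
  by split => //=; [rewrite /strip_row map_nseq | elim: n].
rewrite inj_word_cons => /and3P[lv vw ww] /=.
have [wsk dn zr] := IH ww.
have lv' : v < size (rsk n w) by rewrite size_rsk.
have en := row_of_rsk_None ww vw.
have el : least (first_row_letters (rsk n w)) v = least (first_row w) v by apply: least_ext => x; rewrite zr.
have := insert_strip_row lv' en; have := mem_first_row_insert _ lv' en; rewrite el.
have := leastP (first_row w) v; case: (least (first_row w) v) => [y [yr _ _] mz [_ ->]|_ mz [_ ->]].
  have yz : y \in first_row_letters (rsk n w) by rewrite zr.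
  split; last 1 first.
  - by move=> u; rewrite mz inE mem_filter zr SomeE andbC [y == u]eq_sym.
  - rewrite inj_word_cons wsk andbT -(size_rsk n w) (first_row_letters_lt yz) /=.
    by rewrite -(@row_of_rsk n) // -dn row_of_strip_row // row_of_first_row.
  by rewrite dn.
by split => // u; rewrite mz inE zr andbT.
Qed.

(** A bumped letter was replaced by a smaller one, and the letter standing at
    the place of that one can only have decreased since. *)
Lemma skeleton_gt w x : uniq w -> x \in skeleton w -> exists2 z, z \in first_row w & z < x.
Proof.
elim: w => // v w IH /= /andP[vw uw].
have := leastP (first_row w) v; case: least => [y [yr vy Hy]|_]; last first.
  by case/(IH uw) => z zr zx; exists z; rewrite // inE zr orbT.
have ltvy : v < y.
  rewrite ltn_neqAle vy andbT; apply: contraNneq vw => ->; exact: sub_first_row.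
rewrite inE => /predU1P[->|/(IH uw)[z zr zx]]; first by exists v; rewrite ?inE ?eqxx.
case: (z =P y) => [ezy|/eqP nzy]; first by exists v; rewrite ?inE ?eqxx //; lia.
by exists z => //; rewrite inE mem_filter /= nzy zr orbT.
Qed.

Lemma lds_ge w u u' : u' <= u -> (forall x, x \in w -> u <= x) -> lds w u' = lds w u.
Proof.
move=> le; elim: w => //= v w IH H; rewrite IH; last first.
  by move=> x xw; apply: H; rewrite inE xw orbT.
by have := H v; rewrite inE eqxx => /(_ isT) uv; rewrite uv (leq_trans le uv).
Qed.

(** In [lds_skeleton] with bound 0 the next letter z is the minimum of the first
    row, and all the letters of the skeleton exceed it. *)
Lemma lds_skeleton0 w : uniq w -> w != [::] -> lds w 0 = (lds (skeleton w) 0).+1.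
Proof.
move=> uw w0; rewrite lds_skeleton //; have := leastP (first_row w) 0.
have [v vr] : exists v, v \in first_row w.
  by case: w w0 {uw} => // v w _; exists v; rewrite inE eqxx.
case: least => [z [zr _ Hz]|/(_ v vr) //].
rewrite -(@lds_ge _ z.+1 0) //; first by lia.
by move=> x /(skeleton_gt uw)[z' z'r lz']; have := Hz _ z'r; lia.
Qed.

(** Schensted's theorem for decreasing subsequences: removing the first row
    lowers both the number of rows and [lds] by one. *)
Lemma rowlen_gt0_rsk r n w : inj_word n w -> (0 < rowlen r (rsk n w)) = (r < lds w 0).
Proof.
elim: r w => [|r IH] w ww.
  have := rowlen0_rsk ww (leqnn n); have -> : filter (ltn^~ n) w = w.
    by apply/all_filterP; case/andP: ww.
  move->; case: w ww => // v w; rewrite inj_word_cons => /and3P[/= -> _ _].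
  by lia.
have [wsk dn _] := rsk_skeleton ww.
rewrite -rowlen_strip_row dn IH //; case: w ww {wsk dn} => // v w /andP[uw _].
by rewrite (lds_skeleton0 uw).
Qed.

Lemma lisP w y k : reflect (exists c, [/\ subseq c w, size c = k, sorted gtn c & all (ltn^~ y) c])
   (k <= lis w y).
Proof.
elim: w y k => [|v w IH] y k /=.
  rewrite leqn0; apply: (iffP eqP) => [->|[c [/eqP-> <-]]] //; by exists [::].
apply: (iffP idP).
  case: ifP => vy; last first.
    by case/IH => c [sc <- so al]; exists c; split=> //; apply: subseq_trans sc (subseq_cons w v).
  rewrite leq_max => /orP[/IH[c [sc <- so al]]|].
    by exists c; split=> //; apply: subseq_trans sc (subseq_cons w v).
  case: k => [_|k]; first by exists [::]; rewrite ?sub0seq.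
  rewrite ltnS => /IH[c [sc <- so al]]; exists (v :: c); split=> //=.
  - by rewrite eqxx.
  - by rewrite path_min_sorted //; apply: sub_all al => x /=.
  by rewrite vy; apply: sub_all al => x /= xv; apply: ltn_trans xv vy.
case=> -[|x c] [sc <- // so al] //.
move: sc; rewrite /=; case: eqP => [<-|_] sc.
  move: al so => /= /andP[xy _]; rewrite xy (path_sortedE (rev_trans ltn_trans)) => /andP[al so].
  by rewrite leq_max; apply/orP; right; rewrite ltnS; apply/IH; exists c.
suff : (size (x :: c)) <= lis w y by case: ifP => //= _ h; rewrite leq_max h.
by apply/IH; exists (x :: c).
Qed.

Lemma ldsP w u k : reflect (exists c, [/\ subseq c w, size c = k, sorted ltn c & all (leq u) c])
   (k <= lds w u).
Proof.
elim: w u k => [|v w IH] u k /=.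
  rewrite leqn0; apply: (iffP eqP) => [->|[c [/eqP-> <-]]] //; by exists [::].
apply: (iffP idP).
  case: ifP => uv; last first.
    by case/IH => c [sc <- so al]; exists c; split=> //; apply: subseq_trans sc (subseq_cons w v).
  rewrite leq_max => /orP[/IH[c [sc <- so al]]|].
    by exists c; split=> //; apply: subseq_trans sc (subseq_cons w v).
  case: k => [_|k]; first by exists [::]; rewrite ?sub0seq.
  rewrite ltnS => /IH[c [sc <- so al]]; exists (v :: c); split=> //=.
  - by rewrite eqxx.
  - by rewrite path_min_sorted.
  by rewrite uv; apply: sub_all al => x /= vx; apply: leq_trans uv (ltnW vx).
case=> -[|x c] [sc <- // so al] //.
move: sc; rewrite /=; case: eqP => [<-|_] sc.
  move: al so => /= /andP[ux _]; rewrite ux (path_sortedE ltn_trans) => /andP[al so].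
  by rewrite leq_max; apply/orP; right; rewrite ltnS; apply/IH; exists c.
suff : (size (x :: c)) <= lds w u by case: ifP => //= _ h; rewrite leq_max h.
by apply/IH; exists (x :: c).
Qed.

(** * Counting words by sequences of diagrams *)

Definition shape N (s : tableau) : {set 'I_N * 'I_N} := [set c : 'I_N * 'I_N | c.2 < rowlen c.1 s].

Definition is_diagram N (D : {set 'I_N * 'I_N}) : bool :=
  [forall c in D, forall d : 'I_N * 'I_N, (d.1 <= c.1) && (d.2 <= c.2) ==> (d \in D)].

Lemma is_diagramP N (D : {set 'I_N * 'I_N}) :
  reflect (forall r c r' c' : 'I_N, (r, c) \in D -> r' <= r -> c' <= c -> (r', c') \in D)
    (is_diagram D).
Proof.
apply: (iffP forallP) => [H r c r' c' rD le1 le2|H [r c]].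
  by have /implyP/(_ rD)/forallP/(_ (r', c'))/implyP/= := H (r, c); rewrite le1 le2; apply.
by apply/implyP=> rD; apply/forallP=> -[r' c']; apply/implyP=> /andP[]; apply: H rD.
Qed.

Lemma rowlen_anti s r r' : is_tableau s -> r <= r' -> rowlen r' s <= rowlen r s.
Proof.
move=> vs /subnK <-; elim: (r' - r) => // k IH; rewrite addSn.
exact: leq_trans (tableau_rowlen _ vs) IH.
Qed.

Lemma rowlen_size r s : rowlen r s <= size s.
Proof. exact: count_size. Qed.

Lemma is_diagram_shape N s : is_tableau s -> is_diagram (shape N s).
Proof.
move=> vs; apply/is_diagramP=> r c r' c'; rewrite !inE /= => lc lr lc'.
exact: leq_ltn_trans lc' (leq_trans lc (rowlen_anti vs lr)).
Qed.

(** The corners of a shape are indexed by their rows; this and [sum_addable]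
    translate sums over rows of a tableau into sums over cells, where the
    transposition symmetry is visible. *)
Lemma sum_removable N s (f : {set 'I_N * 'I_N} -> nat) : is_tableau s -> size s < N ->
  \sum_(c in shape N s | is_diagram (shape N s :\ c)) f (shape N s :\ c)
  = \sum_(r < N | removable r s) f (shape N (extract r s).2).
Proof.
move=> vs sN; have lt r : (rowlen r s).-1 < N by have := rowlen_size r s; lia.
pose h (r : 'I_N) := (r, Ordinal (lt r)).
have hP r : (h r \in shape N s) && is_diagram (shape N s :\ h r) = removable r s.
  rewrite inE /=; apply/andP/idP => [[gt /is_diagramP dg]|rm].
    rewrite /removable ltnNge; apply/negP=> le.
    have ltr : r.+1 < N.
      apply: leq_trans sN; rewrite ltnS; apply: (rowlen_gt0_size vs); lia.
    have := dg (Ordinal ltr) (Ordinal (lt r)) r (Ordinal (lt r)); rewrite !inE /= !xpair_eqE !eqxx /=.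
    by rewrite -val_eqE /=; lia.
  have := rm; rewrite /removable => rm'; split; first by lia.
  apply/is_diagramP=> r1 c1 r2 c2; rewrite !inE /= => /andP[ne lc] lr lc'.
  have /is_diagramP dg := is_diagram_shape N vs.
  have := dg r1 c1 r2 c2; rewrite !inE /= => /(_ lc lr lc') ->; rewrite andbT.
  move: ne; apply: contra; rewrite !xpair_eqE -!val_eqE /= => /andP[/eqP e2 /eqP e3].
  have r1r : r1 = r :> nat.
    apply/eqP; rewrite eqn_leq -{2}e2 lr andbT leqNgt; apply/negP=> gt.
    by have := rowlen_anti vs gt; lia.
  by rewrite r1r eqxx /=; move: lc lc'; rewrite r1r e3; lia.
rewrite (reindex_onto h fst) /=; last first.
  move=> [r c] /= /andP[]; rewrite !inE /= => lc /is_diagramP dg.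
  rewrite /h; congr pair; apply/val_inj => /=; apply/eqP; rewrite eqn_leq; apply/andP; split; last by lia.
  rewrite leqNgt; apply/negP=> gt.
  have lt1 : c.+1 < N by have := rowlen_size r s; lia.
  have := dg r (Ordinal lt1) r c; rewrite !inE /= !xpair_eqE !eqxx /=.
  rewrite -val_eqE /=; lia.
under eq_bigl do rewrite hP eqxx andbT.
apply: eq_bigr => r rm; congr f.
have [_ _ _ _ H] := extractP vs rm.
apply/setP=> -[r1 c1]; rewrite !inE /= xpair_eqE -!val_eqE /= (H r1).
case: (eqVneq (val r1) r) => [->|//] /=.
have := H r; rewrite eqxx; lia.
Qed.

Lemma sum_addable N s (f : {set 'I_N * 'I_N} -> nat) : is_tableau s -> size s < N ->
  \sum_(c | (c \notin shape N s) && is_diagram (c |: shape N s)) f (c |: shape N s)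
  = \sum_(r < N | addable r s) f (shape N (Some (val r) :: s)).
Proof.
move=> vs sN; have lt r : rowlen r s < N by have := rowlen_size r s; lia.
pose h (r : 'I_N) := (r, Ordinal (lt r)).
have hE (r : 'I_N) : h r |: shape N s = shape N (Some (val r) :: s).
  apply/setP=> -[r1 c1]; rewrite !inE /= xpair_eqE -!val_eqE /= rowlen_cons SomeE [val r == _]eq_sym.
  by case: (eqVneq (val r1) r) => [->|//] /=; lia.
have hP r : (h r \notin shape N s) && is_diagram (h r |: shape N s) = addable r s.
  rewrite inE /= ltnn /=; apply/idP/idP => [/is_diagramP dg|ad]; last first.
    by rewrite hE; apply: is_diagram_shape; rewrite /= ad.
  case: (posnP r) => [r0|rgt]; first by rewrite /addable r0.
  have ltr : r.-1 < N by have := ltn_ord r; lia.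
  have := dg r (Ordinal (lt r)) (Ordinal ltr) (Ordinal (lt r)).
  rewrite !inE /= !xpair_eqE !eqxx /= leqnn -val_eqE /= leq_pred => /(_ isT isT isT).
  by rewrite /addable; lia.
rewrite (reindex_onto h fst) /=; last first.
  move=> [r c] /= /andP[]; rewrite !inE /= -leqNgt => lc /is_diagramP dg.
  rewrite /h; congr pair; apply/val_inj => /=; apply/eqP; rewrite eqn_leq lc /=.
  rewrite leqNgt; apply/negP=> gt.
  have := dg r c r (Ordinal (lt r)); rewrite !inE /= !xpair_eqE !eqxx /=.
  by rewrite -val_eqE /= ltnn; lia.
under eq_bigl do rewrite hP eqxx andbT.
by apply: eq_bigr => r _; rewrite hE.
Qed.

(** Both sides count the same thing, the insertions that lead from [s0] to [s]:
    on the left by the inserted letter, on the right by the row of the new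
    box. *)
Lemma sum_insert N s0 s : is_tableau s0 -> is_tableau s -> size s0 = size s -> size s < N ->
  \sum_(v < size s | row_of s0 v == None) ((insert v s0).2 == s)
  = \sum_(r < N | removable r s) ((extract r s).2 == s0).
Proof.
move=> v0 vs s0s sN.
transitivity (\sum_(v < size s | row_of s0 v == None)
    \sum_(r < N | removable r s) (insert v s0 == (val r, s))).
  apply: eq_bigr => v /eqP en.
  have lv : v < size s0 by rewrite s0s.
  case: eqP => [e|ne]; last first.
    by rewrite big1 // => r _; case: eqP => // e; case: ne; rewrite e.
  have rl := fun q => rowlen_insert q lv en; rewrite e in rl.
  have rm : removable (insert v s0).1 s.
    by rewrite /removable !rl eqxx; have := tableau_rowlen (insert v s0).1 v0; lia.
  have lr : (insert v s0).1 < N.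
    by apply: leq_trans sN; rewrite ltnS ltnW //; apply: rowlen_gt0_size => //; move: rm; rewrite /removable; lia.
  rewrite (bigD1 (Ordinal lr)) //= big1 ?addn0 => [|r /andP[_ ne]].
    by case: (insert v s0) e => a b /= ->; rewrite eqxx.
  by case: eqP => // e2; move: ne; rewrite -val_eqE /= e2 eqxx.
rewrite exchange_big; apply: eq_bigr => r rm /=.
have [lv en ei _ _] := extractP vs rm.
case: eqP => [e|ne]; last first.
  rewrite big1 // => v /eqP en'; case: eqP => // e; case: ne.
  have lv' : v < size s0 by rewrite s0s.
  by have := insertK lv' en'; rewrite e /= => ->.
rewrite e in en ei.
rewrite (bigD1 (Ordinal lv)) /= ?en // ei eqxx big1 // => v /andP[/eqP en' ne].
case: eqP => // e2; move: ne; rewrite -val_eqE /=.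
have lv' : v < size s0 by rewrite s0s.
by have := insertK lv' en'; rewrite e2 /= => ->; rewrite eqxx.
Qed.

(** A schedule, latest event first, describes the boundary of a Ferrers board
    with n rows: [None] is a column, where one letter is inserted, and [Some b]
    is the end of the largest row still present, [b] telling whether that row
    must have been used.  [alive] is the number of rows still present. *)
Fixpoint alive n (st : seq (option bool)) : nat :=
  if st is a :: st' then if a is Some _ then (alive n st').-1 else alive n st' else n.

(** The words of the fillings of the board, letter by letter the rows of the
    entries in the successive columns. *)
Fixpoint words_at n (st : seq (option bool)) : seq (seq nat) :=
  match st with
  | [::] => [:: [::]]
  | None :: st' => [seq v :: w | w <- words_at n st', v <- [seq v <- iota 0 (alive n st') | v \notin w]]
  | Some b :: st' => [seq w <- words_at n st' | ((alive n st').-1 \in w) == b]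
  end.

Fixpoint wf_schedule n (st : seq (option bool)) : bool :=
  if st is a :: st' then (if a is Some _ then 0 < alive n st' else true) && wf_schedule n st' else true.

(** The tableau attached to a boundary point: the letters whose rows have ended
    are gone. *)
Definition tableau_at n st (w : seq nat) : tableau :=
  rsk (alive n st) (filter (ltn^~ (alive n st)) w).

Fixpoint shapes_ok N (cls : pred {set 'I_N * 'I_N}) n st (w : seq nat) : bool :=
  match st, w with
  | None :: st', _ :: w' => cls (shape N (tableau_at n st w)) && shapes_ok cls n st' w'
  | Some _ :: st', _ => shapes_ok cls n st' w
  | _, _ => true
  end.

(** Number of sequences of diagrams along the schedule that start empty and end
    at [D], grow by a corner at each column, lose a corner at each used row, and
    satisfy [cls] after each column. *)
Fixpoint shape_paths N (cls : pred {set 'I_N * 'I_N}) st (D : {set 'I_N * 'I_N}) : nat :=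
  match st with
  | [::] => (D == set0)
  | None :: st' => cls D * \sum_(c in D | is_diagram (D :\ c)) shape_paths cls st' (D :\ c)
  | Some true :: st' => \sum_(c | (c \notin D) && is_diagram (c |: D)) shape_paths cls st' (c |: D)
  | Some false :: st' => shape_paths cls st' D
  end.

Lemma alive_le n st : alive n st <= n.
Proof. by elim: st => //= -[b|] st //; apply: leq_trans (leq_pred _). Qed.

Lemma words_at_inj n st w : w \in words_at n st -> inj_word n w.
Proof.
elim: st w => [|[b|] st IH] w /=; first by rewrite inE => /eqP->.
  by rewrite mem_filter => /andP[_ /IH].
case/allpairsPdep => w' [v [w'f + ->]]; rewrite mem_filter mem_iota add0n /= => /andP[vw lv].
by rewrite inj_word_cons vw IH // (leq_trans lv (alive_le _ _)).
Qed.

(** The number of words that lead to a given tableau depends only on its shape.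
    A column is undone by [extract], in as many ways as there are corners; the
    end of a used row is undone by putting the largest letter back, in as many
    ways as there are places for a new corner. *)
Lemma sum_words_at N (cls : pred {set 'I_N * 'I_N}) n st s :
  n < N -> wf_schedule n st -> is_tableau s -> size s = alive n st ->
  \sum_(w <- words_at n st) (shapes_ok cls n st w && (tableau_at n st w == s)) = shape_paths cls st (shape N s).
Proof.
move=> nN; elim: st s => [|[b|] st IH] s /=.
- (* the only tableau of empty shape is the empty one *)
  move=> _ vs sn; rewrite big_seq1 /tableau_at /=; congr nat_of_bool.
  apply/eqP/eqP => [<-|s0].
    by apply/setP=> -[r c]; rewrite !inE /= /rowlen count_nseq /= ltn0.
  apply/eqP; rewrite eq_sym; apply/eqP.
  have : forall a, a \in s -> a = None.
    case=> // r rs; have gt : 0 < rowlen r s by rewrite -has_count has_pred1.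
    have lr := rowlen_gt0_size vs gt.
    have l1 : r < N by lia.
    have l2 : 0 < N by lia.
    by have /setP/(_ (Ordinal l1, Ordinal l2)) := s0; rewrite !inE /= gt.
  rewrite -sn; elim: s {s0 vs sn} => //= a s IH H; rewrite (H a) ?inE ?eqxx // -IH //.
  by move=> x xs; apply: H; rewrite inE xs orbT.
- case/andP=> ap wf vs ss.
  have sN : size s < N by have := alive_le n st; lia.
  (* ending a row removes the first entry of the list *)
  have tabS w : w \in words_at n st -> tableau_at n (Some b :: st) w = behead (tableau_at n st w).
    move=> /words_at_inj ww; rewrite /tableau_at /= -drop1.
    have -> : 1 = alive n st - (alive n st).-1 by lia.
    rewrite (drop_rsk (inj_word_filter _ ww)) ?leq_pred // -filter_predI.
    congr rsk; apply: eq_filter => x /=; lia.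
  have memS w : w \in words_at n st ->
      ((alive n st).-1 \in w) = (tableau_at n st w != None :: behead (tableau_at n st w)).
    move=> /words_at_inj ww; rewrite -[LHS]negbK; congr (~~ _).
    have wy := inj_word_filter (alive n st) ww.
    have := row_of_rsk (alive n st).-1 wy.
    rewrite mem_filter /= prednK // leqnn /= => <-.
    rewrite -/(tableau_at n st w); have := size_rsk (alive n st) (filter (ltn^~ (alive n st)) w).
    rewrite -/(tableau_at n st w); case: (tableau_at n st w) => [|a t] /=; first by lia.
    by move=> <-; rewrite row_of_cons /= eqxx eqseq_cons eqxx andbT.
  case: b tabS => tabS; last first.
    transitivity (\sum_(w <- words_at n st) (shapes_ok cls n st w && (tableau_at n st w == None :: s))).
      rewrite big_filter big_mkcond; apply: eq_big_seq => w wf'.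
      rewrite memS // tabS //.
      have := size_rsk (alive n st) (filter (ltn^~ (alive n st)) w).
      rewrite -/(tableau_at n st w); case: (tableau_at n st w) => [|a t] /=; first by lia.
      by rewrite !eqseq_cons eqxx andbT; case: a => [a|]; rewrite /= ?andbF.
    rewrite IH //=; last by rewrite ss prednK.
  rewrite sum_addable //.
  transitivity (\sum_(w <- words_at n st) \sum_(r < N | addable r s)
      (shapes_ok cls n st w && (tableau_at n st w == Some (val r) :: s))).
    rewrite big_filter big_mkcond; apply: eq_big_seq => w wf'.
    rewrite memS // tabS //.
    have := size_rsk (alive n st) (filter (ltn^~ (alive n st)) w).
    have := rsk_tableau (inj_word_filter (alive n st) (words_at_inj wf')).
    rewrite -/(tableau_at n st w); case: (tableau_at n st w) => [|a t] /=; first by lia.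
    case/andP=> va vt [st']; rewrite eqseq_cons eqxx andbT eqb_id.
    case: a va => [r|] va /=; last by rewrite big1 // => r _; rewrite eqseq_cons andbF.
    case: (t =P s) => [ets|nts]; last first.
      rewrite andbF big1 // => r' _; case: eqP; rewrite ?andbF // => -[_ e]; by case: nts.
    have lr : r < N.
      move: va; rewrite /addable; case: (posnP r) => [->|r0 /= h]; first by lia.
      have : 0 < rowlen r.-1 t by lia.
      by move/(rowlen_gt0_size vt); lia.
    rewrite (bigD1 (Ordinal lr)) /= -?ets // eqxx big1 ?addn0 // => r' /andP[_ ne].
    by case: eqP; rewrite ?andbF // => -[e]; move: ne; rewrite -val_eqE /= e eqxx.
  rewrite exchange_big; apply: eq_bigr => r ad /=.
  by rewrite IH //= ?ad ?ss ?prednK.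
(* a column: sum over the inserted letter, then exchange with the corners *)
move=> wf vs ss.
have sN : size s < N by have := alive_le n st; lia.
rewrite big_allpairs_dep sum_removable //.
transitivity (\sum_(w <- words_at n st) \sum_(r < N | removable r s)
   cls (shape N s) * (shapes_ok cls n st w && (tableau_at n st w == (extract r s).2))).
  apply: eq_big_seq => w wf'; have ww := words_at_inj wf'.
  have wy := inj_word_filter (alive n st) ww.
  transitivity ((cls (shape N s) && shapes_ok cls n st w) *
       \sum_(v < size s | row_of (tableau_at n st w) v == None) ((insert v (tableau_at n st w)).2 == s)).
    rewrite big_filter -{1}(subn0 (alive n st)) big_mkord ss big_distrr /=.
    apply: eq_big => [v|v vw]; first by rewrite /tableau_at row_of_rsk // mem_filter /= ltn_ord.
    have -> : tableau_at n (None :: st) (val v :: w) = (insert v (tableau_at n st w)).2.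
      by rewrite /tableau_at /= ltn_ord.
    case: eqP => [->|_]; first by case: (cls _); case: (shapes_ok _ _ _ _).
    by rewrite andbF muln0.
  rewrite (@sum_insert N) ?size_rsk ?rsk_tableau // big_distrr /=.
  apply: eq_bigr => r _; rewrite [(extract r s).2 == _]eq_sym.
  by case: (cls _); case: (shapes_ok _ _ _ _); rewrite /= ?mul1n.
rewrite exchange_big big_distrr /=; apply: eq_bigr => r rm.
by have [_ _ _ vd _] := extractP vs rm; rewrite -big_distrr /= IH // size_extract.
Qed.

(** * Transposing the diagrams *)

Definition swap N (c : 'I_N * 'I_N) := (c.2, c.1).
Definition transp N (D : {set 'I_N * 'I_N}) : {set 'I_N * 'I_N} := [set c | swap c \in D].

Lemma swapK N : involutive (@swap N). Proof. by case. Qed.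

Lemma is_diagram_transp N (D : {set 'I_N * 'I_N}) : is_diagram (transp D) = is_diagram D.
Proof.
by apply/is_diagramP/is_diagramP => H r c r' c' rD lr lc;
  move: rD; have := H c r c' r'; rewrite !inE /swap /= => h rD; apply: h.
Qed.

Lemma transpD1 N (D : {set 'I_N * 'I_N}) c : transp D :\ swap c = transp (D :\ c).
Proof. by apply/setP=> d; rewrite !inE (can2_eq (@swapK N) (@swapK N)). Qed.

Lemma transpU1 N (D : {set 'I_N * 'I_N}) c : swap c |: transp D = transp (c |: D).
Proof. by apply/setP=> d; rewrite !inE (can2_eq (@swapK N) (@swapK N)). Qed.

Lemma shape_paths_transp N (cls cls' : pred {set 'I_N * 'I_N}) st D :
  (forall D, cls' (transp D) = cls D) -> shape_paths cls' st (transp D) = shape_paths cls st D.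
Proof.
move=> H; elim: st D => [|[[]|] st IH] D //=.
- congr nat_of_bool; apply/eqP/eqP => /setP e; apply/setP=> d.
    by have := e (swap d); rewrite !inE swapK.
  by have := e (swap d); rewrite !inE.
- rewrite (reindex_inj (inv_inj (@swapK N))); apply: eq_big => [c|c _].
    by rewrite transpU1 is_diagram_transp inE swapK.
  by rewrite transpU1 IH.
rewrite H; congr (_ * _).
rewrite (reindex_inj (inv_inj (@swapK N))); apply: eq_big => [c|c _].
  by rewrite transpD1 is_diagram_transp inE swapK.
by rewrite transpD1 IH.
Qed.

Definition few_cols N k (D : {set 'I_N * 'I_N}) : bool := [forall c in D, c.2.+1 < k].
Definition few_rows N k (D : {set 'I_N * 'I_N}) : bool := [forall c in D, c.1.+1 < k].

Lemma few_rows_transp N k (D : {set 'I_N * 'I_N}) : few_rows k (transp D) = few_cols k D.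
Proof.
apply/forall_inP/forall_inP => H c cD.
  by have := H (swap c); rewrite inE swapK; apply.
by move: cD; rewrite inE => /H.
Qed.

(** In [few_cols_rsk] and [few_rows_rsk], Schensted's theorem turns the bound on
    the shape into the absence of chains of length [k] among the letters. *)
Lemma few_cols_rsk N k b w : inj_word b w -> b < N -> 0 < k ->
  few_cols k (shape N (rsk b w)) <-> ~ (exists c, [/\ subseq c w, size c = k & sorted gtn c]).
Proof.
move=> ww bN k0.
have ev : (exists c, [/\ subseq c w, size c = k & sorted gtn c]) <-> k <= rowlen 0 (rsk b w).
  have -> : rsk b w = rsk b (filter (ltn^~ b) w).
    by congr rsk; apply/esym/all_filterP; case/andP: ww.
  rewrite (rowlen0_rsk ww) //; split=> [[c' [sc <- so]]|/lisP[c' [sc <- so _]]]; last by exists c'.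
  apply/lisP; exists c'; split=> //; apply/allP=> x /(mem_subseq sc).
  by case/andP: ww => _ /allP; apply.
split=> [/forall_inP H /ev|nc]; last first.
  have lt : rowlen 0 (rsk b w) < k by rewrite ltnNge; apply/negP=> /ev.
  apply/forall_inP=> -[r c]; rewrite inE /= => lc.
  by apply: leq_ltn_trans lt; apply: leq_trans lc (rowlen_anti (rsk_tableau ww) (leq0n r)).
apply/negP; rewrite -ltnNge; case: (posnP (rowlen 0 (rsk b w))) => [-> //|gt].
have l0 : 0 < N by lia.
have l1 : (rowlen 0 (rsk b w)).-1 < N.
  by have := rowlen_size 0 (rsk b w); rewrite size_rsk; lia.
by have := H (Ordinal l0, Ordinal l1); rewrite inE /= prednK // => /(_ (leqnn _)).
Qed.

Lemma few_rows_rsk N k b w : inj_word b w -> b < N -> 0 < k ->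
  few_rows k (shape N (rsk b w)) <-> ~ (exists c, [/\ subseq c w, size c = k & sorted ltn c]).
Proof.
move=> ww bN k0.
have ev : (exists c, [/\ subseq c w, size c = k & sorted ltn c]) <-> k <= lds w 0.
  split=> [[c' [sc <- so]]|/ldsP[c' [sc <- so _]]]; last by exists c'.
  by apply/ldsP; exists c'; split=> //; apply/allP.
split=> [/forall_inP H /ev|nc]; last first.
  have lt : lds w 0 < k by rewrite ltnNge; apply/negP=> /ev.
  apply/forall_inP=> -[r c]; rewrite inE /= => lc.
  apply: leq_ltn_trans lt; rewrite -(rowlen_gt0_rsk _ ww); lia.
apply/negP; rewrite -ltnNge; case: (posnP (lds w 0)) => [-> //|gt].
have gt' : 0 < rowlen (lds w 0).-1 (rsk b w) by rewrite rowlen_gt0_rsk // prednK.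
have l0 : 0 < N by lia.
have l1 : (lds w 0).-1 < N.
  by have := rowlen_gt0_size (rsk_tableau ww) gt'; rewrite size_rsk; lia.
by have := H (Ordinal l1, Ordinal l0); rewrite inE /= prednK // => /(_ gt').
Qed.

(** * The boundary of a Ferrers board *)

(** The ends of the rows y, ..., b - 1, that of row b - 1 coming first in
    time. *)
Definition removals (R : seq nat) y b : seq (option bool) := [seq Some (i \in R) | i <- iota y (b - y)].

(** The schedule of the board whose columns have lengths [bs], the shortest (and
    last) column first, up to the moment when [y] rows are left; [R] lists the
    rows to be used. *)
Fixpoint boundary n R (bs : seq nat) y : seq (option bool) :=
  if bs is b :: bs' then removals R y b ++ None :: boundary n R bs' b else removals R y n.

Lemma removals_cons R y b : y < b -> removals R y b = Some (y \in R) :: removals R y.+1 b.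
Proof. by move=> lt; rewrite /removals -(subnSK lt). Qed.

Lemma removals_nil R y : removals R y y = [::].
Proof. by rewrite /removals subnn. Qed.

Lemma down_ind b (P : nat -> Prop) :
  P b -> (forall y, y < b -> P y.+1 -> P y) -> forall y, y <= b -> P y.
Proof.
move=> Pb step y /subKn <-; elim: (b - y) => [|m]; first by rewrite subn0.
case: (leqP b m) => [bm|mb IH]; last first.
  by apply: step; [lia | rewrite subnSK].
by have -> : b - m.+1 = b - m by lia.
Qed.

Section Removals.
Variables (n : nat) (R : seq nat) (st : seq (option bool)).
Let b := alive n st.

Lemma alive_removals y : y <= b -> alive n (removals R y b ++ st) = y.
Proof.
move: y; apply: down_ind => [|y lt IH]; first by rewrite removals_nil.
by rewrite removals_cons //= IH.
Qed.

Lemma wf_removals y : y <= b -> wf_schedule n (removals R y b ++ st) = wf_schedule n st.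
Proof.
move: y; apply: down_ind => [|y lt IH]; first by rewrite removals_nil.
by rewrite removals_cons //= alive_removals.
Qed.

Lemma mem_words_removals y w : y <= b ->
  (w \in words_at n (removals R y b ++ st)) =
  (w \in words_at n st) && all (fun i => (i \in w) == (i \in R)) (iota y (b - y)).
Proof.
move: y; apply: down_ind => [|y lt IH]; first by rewrite removals_nil subnn andbT.
rewrite removals_cons // -(subnSK lt) /= mem_filter IH alive_removals //=.
by rewrite andbCA.
Qed.

Lemma shapes_ok_removals N (cls : pred {set 'I_N * 'I_N}) y w :
  shapes_ok cls n (removals R y b ++ st) w = shapes_ok cls n st w.
Proof. by rewrite /removals; elim: (iota _ _). Qed.
End Removals.

Lemma uniq_words_at n st : uniq (words_at n st).
Proof.
elim: st => [|[b|] st IH] //=; first by rewrite filter_uniq.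
apply: allpairs_uniq_dep => //; first by move=> w _; rewrite filter_uniq ?iota_uniq.
by move=> [w v] [w' v'] _ _ /= [-> ->].
Qed.

Lemma boundary_spec n R bs y : path leq y bs -> all (leq^~ n) (y :: bs) ->
  alive n (boundary n R bs y) = y /\ wf_schedule n (boundary n R bs y).
Proof.
elim: bs y => [|b bs IH] y /=.
  move=> _ /andP[yn _]; rewrite -[removals _ _ _]cats0; split.
    exact: (@alive_removals n R [::]).
  by rewrite (@wf_removals n R [::]).
case/andP=> yb pb /and3P[yn bn an].
have h : all (leq^~ n) (b :: bs) by rewrite /= bn an.
have [al wf] := IH b pb h.
have := @wf_removals n R (None :: boundary n R bs b) y.
have := @alive_removals n R (None :: boundary n R bs b) y.
by rewrite /= al => H1 H2; split; [apply: H1 | rewrite H2].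
Qed.

(** The conditions checked at the ends of rows may be checked on the final word,
    as later letters are smaller than the rows that have ended. *)
Lemma mem_words_boundary n R bs y w : path leq y bs -> all (leq^~ n) (y :: bs) ->
  (w \in words_at n (boundary n R bs y)) =
  [&& size w == size bs, all2 ltn w bs, uniq w &
      all (fun i => (i \in w) == (i \in R)) (iota y (n - y))].
Proof.
elim: bs y w => [|b bs IH] y w /=.
  move=> _ /andP[yn _]; rewrite -[removals _ _ _]cats0.
  rewrite (@mem_words_removals n R [::]) //= inE.
  by case: w.
case/andP=> yb pb /and3P[yn bn an].
have h : all (leq^~ n) (b :: bs) by rewrite /= bn an.
have [al wf] := boundary_spec R pb h.
have := @mem_words_removals n R (None :: boundary n R bs b) y w; rewrite /= al => -> //.
have -> : n - y = (b - y) + (n - b) by lia.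
rewrite iotaD all_cat subnKC //.
case: w => [|v w] /=.
  apply/negbTE/negP=> /andP[/allpairsPdep[w [v [_ _ //]]]].
rewrite eqSS.
have -> : (v :: w \in [seq v :: w | w <- words_at n (boundary n R bs b), v <- [seq v <- iota 0 b | v \notin w]])
   = [&& v \notin w, v < b & w \in words_at n (boundary n R bs b)].
  apply/allpairsPdep/and3P => [[w' [v' [w'f + [-> ->]]]]|[vw vb wf']].
    by rewrite mem_filter mem_iota add0n /= => /andP[-> ->].
  by exists w, v; split=> //; rewrite mem_filter vw mem_iota.
rewrite IH //.
case: (ltnP v b) => vb; rewrite ?andbF //=.
have -> : all (fun i => (i \in v :: w) == (i \in R)) (iota b (n - b)) =
          all (fun i => (i \in w) == (i \in R)) (iota b (n - b)).
  apply: eq_in_all => i; rewrite mem_iota => /andP[bi _]; rewrite inE.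
  by have -> : (i == v) = false by lia.
by case: (v \notin w); case: (size w == size bs); case: (all2 _ _ _); case: (uniq w); rewrite /= ?andbF // andbC.
Qed.

(** * Fillings of Ferrers boards *)

Lemma sorted_sub (T : eqType) (lt : rel T) (p z : seq T) :
  transitive lt -> irreflexive lt -> sorted lt p -> sorted lt z -> {subset p <= z} -> subseq p z.
Proof.
move=> tr ir sp sz sub; have -> : p = filter (mem p) z.
  apply: (irr_sorted_eq tr ir) => //; first exact: sorted_filter.
  by move=> x; rewrite mem_filter /=; case: (boolP (x \in p)) => // /sub ->.
exact: filter_subseq.
Qed.

Lemma subseq_unzip1 (T1 T2 : eqType) (c : seq T1) (z : seq (T1 * T2)) :
  subseq c (unzip1 z) -> exists2 p, subseq p z & c = unzip1 p.
Proof.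
case/subseqP => m sm ->; exists (mask m z); first exact: mask_subseq.
by rewrite /unzip1 map_mask.
Qed.

Lemma uniq_map_inj (T1 T2 : eqType) (f : T1 -> T2) (s : seq T1) :
  uniq (map f s) -> {in s &, injective f}.
Proof.
elim: s => //= a s IH /andP[fa us] x y; rewrite !inE.
case/predU1P=> [->|xs] /predU1P[->|ys] // ef; last exact: IH.
  by case/negP: fa; rewrite ef map_f.
by case/negP: fa; rewrite -ef map_f.
Qed.

Section Ferrers.
Variables (n k : nat) (A : rel 'I_n).
Hypothesis A_closed : forall i j i' j' : 'I_n, A i j -> i' <= i -> j <= j' -> A i' j'.

(** An occurrence inside the board [A] of the identity pattern of size [k] (for
    [e := ltn]) or of the antidiagonal one (for [e := gtn]) among the cells [U];
    that the whole rectangle spanned by it lies in the board is the containment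
    used for Ferrers boards. *)
Definition has_chain (e : rel nat) (U : {set 'I_n * 'I_n}) : bool :=
  [exists r : {ffun 'I_k -> 'I_n}, exists c : {ffun 'I_k -> 'I_n},
    [&& increasing c, [forall i, (r i, c i) \in U],
        [forall i : 'I_k, forall j : 'I_k, (i < j) ==> e (r i) (r j)] &
        [forall i, forall j, A (r i) (c j)]]].

(** Placements of non-attacking rooks on the board [A] that occupy exactly the
    rows [R] and the columns [C]. *)
Definition filling (R C : {set 'I_n}) (U : {set 'I_n * 'I_n}) : bool :=
  [&& [forall x in U, A x.1 x.2], [set x.1 | x in U] == R, [set x.2 | x in U] == C,
      dinjectiveb fst U & dinjectiveb snd U].

Definition col_bound (j : 'I_n) : nat := \max_(i | A i j) i.+1.

Lemma col_boundP i j : A i j = (i < col_bound j).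
Proof.
apply/idP/idP => [aij|]; first exact: (@leq_bigmax_cond _ (A^~ j) (fun i => i.+1)).
apply: contraTT => na; rewrite -leqNgt; apply/bigmax_leqP => i' ai'.
rewrite ltnNge; apply: contra na => le; exact: A_closed ai' le (leqnn _).
Qed.

Lemma col_bound_mono (j j' : 'I_n) : j <= j' -> col_bound j <= col_bound j'.
Proof.
move=> le; apply/bigmax_leqP => i aij.
by rewrite -col_boundP; apply: A_closed aij _ le.
Qed.

Lemma col_bound_le j : col_bound j <= n.
Proof. by apply/bigmax_leqP => i _; apply: ltn_ord. Qed.

Definition ltcol : rel (nat * 'I_n) := fun x y => x.2 < y.2.

Lemma ltcol_trans : transitive ltcol.
Proof. by move=> y x z; apply: ltn_trans. Qed.

Lemma ltcol_irr : irreflexive ltcol.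
Proof. by move=> x; apply: ltnn. Qed.

(** [has_chain] for a filling given as the list of its (row, column) pairs. *)
Definition chain_list (e : rel nat) (z : seq (nat * 'I_n)) : Prop :=
  exists p, [/\ subseq p z, size p = k, sorted e (unzip1 p) &
    forall x y, x \in p -> y \in p -> x.1 < col_bound y.2].

Definition cells_of (z : seq (nat * 'I_n)) : {set 'I_n * 'I_n} :=
  [set x | (val x.1, x.2) \in z].

Lemma sorted_enum_map (e : rel nat) (f : 'I_k -> nat) :
  (forall i j : 'I_k, i < j -> e (f i) (f j)) -> sorted e (map f (enum 'I_k)).
Proof.
move=> H; rewrite sorted_map; apply: (@sub_sorted _ (relpre val ltn)); first exact: H.
by rewrite -sorted_map val_enum_ord iota_ltn_sorted.
Qed.

(** Sorting by columns turns an occurrence into a sublist. *)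
Lemma has_chain_list e z : transitive e -> 0 < k -> sorted ltcol z ->
  (forall x, x \in z -> x.1 < n) -> has_chain e (cells_of z) <-> chain_list e z.
Proof.
move=> tre k0 sz zn; split.
  case/existsP => r /existsP[c /and4P[/forallP ic /forallP ru /forallP er /forallP ar]].
  exists [seq (val (r i), c i) | i <- enum 'I_k]; split.
  - apply: (sorted_sub ltcol_trans ltcol_irr) => //.
      rewrite sorted_map; apply: (@sub_sorted _ (relpre val ltn)).
        by move=> i j /= ij; have /forallP/(_ j)/implyP := ic i; apply.
      by rewrite -sorted_map val_enum_ord iota_ltn_sorted.
    by move=> _ /mapP[i _ ->]; have := ru i; rewrite inE.
  - by rewrite size_map size_enum_ord.
  - rewrite /unzip1 -map_comp; apply: sorted_enum_map => i j ij /=.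
    by have /forallP/(_ j)/implyP := er i; apply.
  move=> _ _ /mapP[i _ ->] /mapP[j _ ->] /=; rewrite -col_boundP.
  by have /forallP := ar i; apply.
case=> p [sub sp so Ap].
case: p sub sp so Ap => [|[v0 j0] p'] sub sp so Ap; first by move: k0; rewrite -sp.
set x0 := (v0, j0) in sub sp so Ap; set p := x0 :: p' in sub sp so Ap.
have inp (i : 'I_k) : nth x0 p i \in p by rewrite mem_nth // sp.
have rE (i : 'I_k) : insubd j0 (nth x0 p i).1 = (nth x0 p i).1 :> nat.
  by rewrite val_insubd zn // (mem_subseq sub).
apply/existsP; exists [ffun i : 'I_k => insubd j0 (nth x0 p i).1].
apply/existsP; exists [ffun i : 'I_k => (nth x0 p i).2].
have sop : sorted ltcol p by apply: subseq_sorted sub sz; apply: ltcol_trans.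
apply/and4P; split.
- apply/forallP=> i; apply/forallP=> j; apply/implyP=> ij; rewrite !ffunE.
  by apply: (sorted_ltn_nth ltcol_trans x0 sop); rewrite ?inE ?sp.
- by apply/forallP=> i; rewrite !ffunE inE /= rE -surjective_pairing (mem_subseq sub).
- apply/forallP=> i; apply/forallP=> j; apply/implyP=> ij; rewrite !ffunE !rE.
  have := sorted_ltn_nth tre v0 so; rewrite size_map => /(_ i j).
  by rewrite !(nth_map x0) ?inE ?sp //; apply.
by apply/forallP=> i; apply/forallP=> j; rewrite !ffunE col_boundP rE; apply: Ap.
Qed.

Section Words.
Variables (N : nat) (cls : pred {set 'I_N * 'I_N}) (e : rel nat).
Hypothesis clsP : forall b w, inj_word b w -> b <= n ->
  cls (shape N (rsk b w)) <-> ~ (exists c, [/\ subseq c w, size c = k & sorted e c]).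
Hypothesis k0 : 0 < k.

(** The condition on the shape at a column says that no chain of length [k] uses
    only letters alive there.  A chain of the filling lies in the board iff all
    its rows are alive at its last column, so it is detected when that column is
    processed; conversely letters that precede a column lie in longer
    columns. *)
Lemma shapes_ok_chain R cs w y :
  sorted (fun i j : 'I_n => i < j) cs -> size w = size cs -> inj_word n w ->
  path leq y (map col_bound cs) -> y <= n -> all2 ltn w (map col_bound cs) ->
  shapes_ok cls n (boundary n R (map col_bound cs) y) w <-> ~ chain_list e (zip w cs).
Proof.
elim: cs w y => [|j cs IH] [|v w] y //=.
  move=> _ _ _ _ _ _; split=> [_ [p [+ sp _ _]]|_].
    by move/eqP=> p0; move: k0; rewrite -sp p0.
  by rewrite -[removals _ _ _]cats0 shapes_ok_removals.
move=> pcs [sw] wvw /andP[yb pb] yn /andP[vb a2].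
have scs : sorted (fun i j : 'I_n => i < j) cs by apply: path_sorted pcs.
have [] := andP wvw; rewrite /= => /andP[vw uw] /andP[vn wn].
have ww : inj_word n w by rewrite /inj_word uw.
have an : all (leq^~ n) (col_bound j :: map col_bound cs).
  by apply/allP => b /=; rewrite inE => /predU1P[->|/mapP[j' _ ->]]; apply: col_bound_le.
have [al _] := boundary_spec R pb an.
have := @shapes_ok_removals n R (None :: boundary n R (map col_bound cs) (col_bound j)) N cls y (v :: w).
rewrite [alive _ _]al => -> /=.
rewrite {1}/tableau_at [alive _ _]al.
have IHw := IH w (col_bound j) scs sw ww pb (col_bound_le j) a2.
have wb : inj_word (col_bound j) (filter (ltn^~ (col_bound j)) (v :: w)) by apply: inj_word_filter wvw.
have cP := clsP wb (col_bound_le j).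
have e1 : unzip1 (zip w cs) = w by rewrite unzip1_zip // sw.
have e2 : unzip2 (zip w cs) = cs by rewrite unzip2_zip // sw.
have lej x : x \in (v, j) :: zip w cs -> j <= x.2.
  rewrite inE => /predU1P[->//|xz]; have xc : x.2 \in cs by rewrite -e2 map_f.
  by have /allP/(_ _ xc)/ltnW := order_path_min (fun _ _ _ => @ltn_trans _ _ _) pcs.
split=> [/andP[/cP c1 /IHw c2] [p [sub sp so Ap]]|H].
  case: p sub sp so Ap => [|x p] sub sp so Ap; first by move: k0; rewrite -sp.
  move: sub => /=; case: eqP => [ex sub|_ sub]; last by apply: c2; exists (x :: p).
  apply: c1; exists (unzip1 (x :: p)); split=> //; last by rewrite size_map.
  rewrite subseq_filter; apply/andP; split.
    by apply/allP=> _ /mapP[q qp ->]; have := Ap q x qp; rewrite inE eqxx ex; apply.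
  have := map_subseq fst (_ : subseq (x :: p) ((v, j) :: zip w cs)).
  by rewrite /= -/(unzip1 (zip w cs)) e1 ex eqxx; apply.
apply/andP; split; [apply/cP|apply/IHw].
  case=> c []; rewrite subseq_filter => /andP[/allP cb sc] sz so.
  have [p sp ep] : exists2 p, subseq p ((v, j) :: zip w cs) & c = unzip1 p.
    by apply: subseq_unzip1; rewrite /= -/(unzip1 (zip w cs)) e1.
  apply: H; exists p; split=> //; first by rewrite -sz ep size_map.
    by rewrite /= -ep.
  move=> x q xp qp.
  have xb : x.1 < col_bound j by apply: cb; rewrite ep map_f.
  by apply: leq_trans xb (col_bound_mono (lej q (mem_subseq sp qp))).
case=> p [sub sp so Ap]; apply: H; exists p; split=> //.
exact: subseq_trans sub (subseq_cons _ _).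
Qed.

Lemma sorted_enum (C : {set 'I_n}) : sorted (fun i j : 'I_n => i < j) (enum C).
Proof.
apply: sorted_filter; first by move=> ? ? ?; apply: ltn_trans.
by rewrite -enumT -[sorted _ _]/(sorted (relpre val ltn) (enum _)) -sorted_map val_enum_ord iota_ltn_sorted.
Qed.

Definition schedule_of (R C : {set 'I_n}) := boundary n (map val (enum R)) (map col_bound (enum C)) 0.

Lemma col_bounds_ok (C : {set 'I_n}) :
  path leq 0 (map col_bound (enum C)) /\ all (leq^~ n) (0 :: map col_bound (enum C)).
Proof.
split; last first.
  by apply/allP => b /=; rewrite inE => /predU1P[->//|/mapP[j' _ ->]]; apply: col_bound_le.
rewrite path_min_sorted; last by apply/allP.
rewrite sorted_map; apply: sub_sorted (sorted_enum C) => i j ij.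
exact/col_bound_mono/ltnW.
Qed.

Lemma mem_words (R C : {set 'I_n}) w :
  (w \in words_at n (schedule_of R C)) =
  [&& size w == #|C|, all2 ltn w (map col_bound (enum C)), uniq w &
      all (fun i => (i \in w) == (i \in map val (enum R))) (iota 0 n)].
Proof.
have [h1 h2] := col_bounds_ok C.
by rewrite (mem_words_boundary _ w h1 h2) size_map -cardE subn0.
Qed.

Definition cells_of_word (C : {set 'I_n}) (w : seq nat) := cells_of (zip w (enum C)).

(** The map from words to fillings is a bijection, by this lemma and the next
    two. *)
Lemma cells_of_word_filling (R C : {set 'I_n}) w : w \in words_at n (schedule_of R C) -> filling R C (cells_of_word C w).
Proof.
move=> wf; have /andP[_ wn] := words_at_inj wf.
move: wf; rewrite mem_words => /and4P[/eqP sw a2 uw /allP wR].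
rewrite /cells_of_word; set z := zip w (enum C).
have e1 : unzip1 z = w by rewrite unzip1_zip // sw cardE.
have e2 : unzip2 z = enum C by rewrite unzip2_zip // sw cardE.
have Az x : x \in z -> x.1 < col_bound x.2.
  move: a2; rewrite all2E => /andP[_].
  have -> : zip w (map col_bound (enum C)) = map (fun x => (x.1, col_bound x.2)) z.
    have := zip_map id col_bound; move: (enum C) @z {e1 e2} => cs; rewrite /=.
    by elim: (w) cs => [|a w' IHw] [|c cs] //= H; rewrite IHw.
  by rewrite all_map => /allP/(_ x).
apply/and5P; split.
- by apply/forall_inP=> -[i j]; rewrite inE /= col_boundP => /Az.
- apply/eqP/setP=> i; apply/imsetP/idP => [[[i' j]]|iR].
    rewrite inE /= => iz ->; have iw : val i' \in w by rewrite -e1; apply: (map_f fst iz).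
    have := wR (val i'); rewrite mem_iota add0n ltn_ord iw => /(_ isT)/eqP/esym.
    by rewrite mem_map ?mem_enum //; apply: val_inj.
  have : val i \in w.
    have := wR (val i); rewrite mem_iota add0n ltn_ord mem_map ?mem_enum ?iR; last exact: val_inj.
    by move=> /(_ isT)/eqP ->.
  by rewrite -e1 => /mapP[[a j] /= az ea]; exists (i, j); rewrite ?inE //= ea.
- apply/eqP/setP=> j; apply/imsetP/idP => [[[i j']]|jC].
    by rewrite inE /= => iz ->; rewrite -mem_enum -e2; apply: (map_f snd iz).
  have : j \in unzip2 z by rewrite e2 mem_enum.
  move=> /mapP[[a j'] /= az ea].
  have an : a < n.
    by have /allP := wn; apply; rewrite -e1; apply: (map_f fst az).
  by exists (Ordinal an, j'); rewrite ?inE.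
- apply/dinjectiveP=> -[i j] [i' j']; rewrite !inE /= => iz iz' e'; move: iz iz'; rewrite e' => iz iz'.
  have := @uniq_map_inj _ _ fst z; rewrite -/(unzip1 z) e1 => /(_ uw _ _ iz iz' erefl) [->] //.
apply/dinjectiveP=> -[i j] [i' j']; rewrite !inE /= => iz iz' e'; move: iz iz'; rewrite e' => iz iz'.
have := @uniq_map_inj _ _ snd z; rewrite -/(unzip2 z) e2 => /(_ (enum_uniq _) _ _ iz iz' erefl) [] /val_inj ->.
by [].
Qed.

Lemma cells_of_word_inj (R C : {set 'I_n}) : {in words_at n (schedule_of R C) &, injective (cells_of_word C)}.
Proof.
move=> w w' wf wf'; have /andP[_ /allP wn] := words_at_inj wf.
move: wf wf'; rewrite !mem_words => /and4P[/eqP sw _ _ _] /and4P[/eqP sw' _ _ _] eU.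
have e2 : unzip2 (zip w (enum C)) = enum C by rewrite unzip2_zip // sw cardE.
have e2' : unzip2 (zip w' (enum C)) = enum C by rewrite unzip2_zip // sw' cardE.
apply: (@eq_from_nth _ 0) => [|t tw]; first by rewrite sw sw'.
have tC : t < size (enum C) by rewrite -cardE -sw.
have [j0 _] : exists j0 : 'I_n, true by case: (enum C) tC => // j0 _ _; exists j0.
have tn := wn _ (mem_nth 0 tw).
have : (Ordinal tn, nth j0 (enum C) t) \in cells_of_word C w.
  rewrite inE /=; have := @mem_nth _ (0, j0) (zip w (enum C)) t.
  by rewrite nth_zip ?size_zip ?sw ?cardE // minnn; apply.
rewrite eU inE /= => tz.
have tz' : (nth 0 w' t, nth j0 (enum C) t) \in zip w' (enum C).
  have := @mem_nth _ (0, j0) (zip w' (enum C)) t.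
  by rewrite nth_zip ?size_zip ?sw' ?cardE // minnn; apply.
have := @uniq_map_inj _ _ snd (zip w' (enum C)).
by rewrite -/(unzip2 _) e2' => /(_ (enum_uniq _) _ _ tz tz' erefl) [].
Qed.

Lemma cells_of_word_onto (R C : {set 'I_n}) U : filling R C U ->
  exists2 w, w \in words_at n (schedule_of R C) & U = cells_of_word C w.
Proof.
case/and5P=> /forall_inP UA /eqP UR /eqP UC /dinjectiveP i1 /dinjectiveP i2.
pose f (j : 'I_n) : nat := if [pick i | (i, j) \in U] is Some i then val i else 0.
have fU i j : (i, j) \in U -> f j = i.
  move=> ij; rewrite /f; case: pickP => [i' i'j|/(_ i)]; last by rewrite ij.
  by have [->] := i2 _ _ i'j ij erefl.
have Uf j : j \in C -> exists2 i, (i, j) \in U & f j = i.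
  by rewrite -UC => /imsetP[[i j'] iU /= ->]; exists i => //; apply: fU.
have zE : zip (map f (enum C)) (enum C) = [seq (f j, j) | j <- enum C].
  by elim: (enum C) => //= a s ->.
exists (map f (enum C)); last first.
  apply/setP=> -[i j]; rewrite inE /= zE; apply/idP/mapP => [ij|[j' + [ei ->]]].
    exists j; last by rewrite (fU i).
    by rewrite mem_enum -UC; apply/imsetP; exists (i, j).
  by rewrite mem_enum => /Uf[i' i'U ef]; move: i'U; have -> // : i' = i by apply: val_inj; rewrite /= -ef.
rewrite mem_words size_map -cardE eqxx /=; apply/and3P; split.
- have : all (fun j => f j < col_bound j) (enum C).
    by apply/allP=> j; rewrite mem_enum => /Uf[i iU ->]; rewrite -col_boundP; apply: (UA _ iU).
  by elim: (enum C) => //= a s IHs /andP[-> /IHs].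
- rewrite map_inj_in_uniq ?enum_uniq // => j j'; rewrite !mem_enum => /Uf[i iU ->] /Uf[i' iU' ->] /val_inj e'.
  by move: iU'; rewrite -e' => iU'; have [] := i1 _ _ iU iU' erefl.
apply/allP=> i; rewrite mem_iota add0n => /andP[_ ln].
apply/eqP; apply/mapP/mapP => [[j]|[i']].
  rewrite mem_enum => /Uf[i' iU -> ->]; exists i' => //.
  by rewrite mem_enum -UR; apply/imsetP; exists (i', j).
rewrite mem_enum -UR => /imsetP[[i1' j] iU /= ->] ->; exists j; last by rewrite (fU i1').
by rewrite mem_enum -UC; apply/imsetP; exists (i1', j).
Qed.

Lemma card_fillings (R C : {set 'I_n}) : transitive e -> n < N ->
  #|[set U | filling R C U & ~~ has_chain e U]| = shape_paths cls (schedule_of R C) set0.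
Proof.
move=> tre nN; have [h1 h2] := col_bounds_ok C.
have [al wf] := boundary_spec (map val (enum R)) h1 h2.
have := @sum_words_at N cls n (schedule_of R C) [::] nN wf isT (esym al).
have -> : shape N [::] = set0 by apply/setP=> c; rewrite !inE.
move=> <-.
have -> : \sum_(w <- words_at n (schedule_of R C)) (shapes_ok cls n (schedule_of R C) w && (tableau_at n (schedule_of R C) w == [::]))
   = size (filter (shapes_ok cls n (schedule_of R C)) (words_at n (schedule_of R C))).
  rewrite size_filter -sum1_count [RHS]big_mkcond; apply: eq_bigr => w _.
  have -> : tableau_at n (schedule_of R C) w = [::].
    by apply/nilP; rewrite /nilp size_rsk al.
  by rewrite eqxx andbT; case: shapes_ok.
rewrite -(size_map (cells_of_word C)) -(card_uniqP _); last first.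
  rewrite map_inj_in_uniq ?filter_uniq ?uniq_words_at // => w w'; rewrite !mem_filter.
  by move=> /andP[_ wf1] /andP[_ wf2]; apply: cells_of_word_inj wf1 wf2.
have key w : w \in words_at n (schedule_of R C) ->
    shapes_ok cls n (schedule_of R C) w = ~~ has_chain e (cells_of_word C w).
  move=> wf'; have ww := words_at_inj wf'; have /andP[_ /allP wn] := ww.
  move: wf'; rewrite mem_words => /and4P[/eqP sw a2 _ _].
  have sw' : size w = size (enum C) by rewrite sw cardE.
  have bp := shapes_ok_chain (map val (enum R)) (sorted_enum C) sw' ww h1 (leq0n n) a2.
  have e1 : unzip1 (zip w (enum C)) = w by rewrite unzip1_zip // sw'.
  have e2 : unzip2 (zip w (enum C)) = enum C by rewrite unzip2_zip // sw'.
  have hp : has_chain e (cells_of_word C w) <-> chain_list e (zip w (enum C)).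
    apply: has_chain_list => //.
      have : sorted (fun i j : 'I_n => i < j) (unzip2 (zip w (enum C))).
        by rewrite e2; apply: sorted_enum.
      by rewrite sorted_map.
    by move=> x xz; apply: wn; rewrite -e1 map_f.
  apply/idP/idP => [/bp H|/negP H]; first by apply/negP=> /hp.
  by apply/bp=> /hp.
apply: eq_card => U; rewrite inE; apply/andP/mapP => [[fU nc]|[w + ->]].
  have [w wf' eU] := cells_of_word_onto fU; exists w => //.
  by rewrite mem_filter wf' key // -eU nc.
by rewrite mem_filter => /andP[bw wf']; rewrite -key // bw cells_of_word_filling.
Qed.
End Words.

(** The theorem of Backelin, West and Xin for the identity and antidiagonal
    patterns.  Columns are read from right to left here, so that the identity
    pattern becomes a decreasing chain of letters, bounded by the number of
    rows of the tableaux, and the antidiagonal pattern an increasing one. *)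
Theorem card_fillings_ltn_gtn (R C : {set 'I_n}) : 0 < k ->
  #|[set U | filling R C U & ~~ has_chain ltn U]| =
  #|[set U | filling R C U & ~~ has_chain gtn U]|.
Proof.
move=> k0.
rewrite (@card_fillings n.+1 (@few_rows n.+1 k) ltn) //; last 2 first.
- by move=> b w wb bn; apply: few_rows_rsk.
- exact: ltn_trans.
rewrite (@card_fillings n.+1 (@few_cols n.+1 k) gtn) //; last 2 first.
- by move=> b w wb bn; apply: few_cols_rsk.
- by move=> y x z h1 h2; apply: ltn_trans h2 h1.
have e0 : transp set0 = set0 :> {set 'I_n.+1 * 'I_n.+1} by apply/setP=> c; rewrite !inE.
by rewrite -{1}e0; apply: shape_paths_transp => D; apply: few_rows_transp.
Qed.
End Ferrers.

(** * Signed permutation matrices and their submatrices *)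

Section SignedPerm.
Variables (n : nat) (p : B n).

Lemma B_entry i j : [|| p i j == 0%R, p i j == 1%R | p i j == (-1)%R].
Proof.
by have /and3P[/forallP/(_ i)/forallP/(_ j)] := mx_of_BP p; rewrite !inE.
Qed.

Lemma B_row i : exists j, p i j != 0%R.
Proof.
have /and3P[_ /forallP/(_ i)/cards1P[j Ej] _] := mx_of_BP p.
by exists j; move/setP/(_ j): Ej; rewrite !inE eqxx.
Qed.

Lemma B_row_inj i j j' : p i j != 0%R -> p i j' != 0%R -> j = j'.
Proof.
have /and3P[_ /forallP/(_ i)/cards1P[j0 Ej] _] := mx_of_BP p.
have nz j1 : (p i j1 != 0%R) = (j1 == j0) by move/setP/(_ j1): Ej; rewrite !inE.
by rewrite !nz => /eqP-> /eqP->.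
Qed.

Lemma B_col j : exists i, p i j != 0%R.
Proof.
have /and3P[_ _ /forallP/(_ j)/cards1P[i Ei]] := mx_of_BP p.
by exists i; move/setP/(_ i): Ei; rewrite !inE eqxx.
Qed.

Lemma B_col_inj i i' j : p i j != 0%R -> p i' j != 0%R -> i = i'.
Proof.
have /and3P[_ _ /forallP/(_ j)/cards1P[i0 Ei]] := mx_of_BP p.
have nz i1 : (p i1 j != 0%R) = (i1 == i0) by move/setP/(_ i1): Ei; rewrite !inE.
by rewrite !nz => /eqP-> /eqP->.
Qed.
End SignedPerm.

Lemma SI_entry_sym n (p : B n) : p \in SI n -> forall i j, p i j = p j i.
Proof.
by rewrite SI_sym => /eqP e i j; rewrite -[in LHS]e mxE.
Qed.

Lemma increasingP n k (f : {ffun 'I_k -> 'I_n}) :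
  reflect (forall i j : 'I_k, i < j -> f i < f j) (increasing f).
Proof.
apply: (iffP forallP) => [H i j ij|H i].
  by have /forallP/(_ j)/implyP := H i; apply.
by apply/forallP=> j; apply/implyP; apply: H.
Qed.

Lemma increasing_inj n k (f : {ffun 'I_k -> 'I_n}) : increasing f -> injective f.
Proof.
move/increasingP=> H i j e; apply/val_inj/eqP.
by case: ltngtP => // /H; rewrite e ltnn.
Qed.

(** A submatrix that has the right nonzero entries, at least one in each row, has
    no room for others. *)
Lemma mxsub_eqP n k (p : B n) (tau : 'M[int]_k) (f g : {ffun 'I_k -> 'I_n}) :
  (forall u, exists v, tau u v != 0%R) -> increasing g ->
  (forall u v, tau u v != 0%R -> p (f u) (g v) = tau u v) -> mxsub f g p = tau.
Proof.
move=> nz ig H; apply/matrixP=> u v; rewrite mxE.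
case: (eqVneq (tau u v) 0%R) => [e0|/H //]; rewrite e0; apply/eqP/negPn/negP=> pnz.
have [v0 tnz] := nz u; have := H _ _ tnz => e.
have : g v0 = g v by apply: B_row_inj pnz; rewrite e.
by move/(increasing_inj ig) => ev; rewrite ev e0 eqxx in tnz.
Qed.

(** Selections of rows (or columns) of a block matrix, block by block. *)
Definition fcat n a b (f : {ffun 'I_a -> 'I_n}) (g : {ffun 'I_b -> 'I_n}) : {ffun 'I_(a + b) -> 'I_n} :=
  [ffun t => match split t with inl i => f i | inr j => g j end].

Lemma fcatl n a b (f : {ffun 'I_a -> 'I_n}) (g : {ffun 'I_b -> 'I_n}) i :
  fcat f g (lshift b i) = f i.
Proof. by rewrite ffunE -[lshift b i]/(unsplit (inl _ i)) unsplitK. Qed.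

Lemma fcatr n a b (f : {ffun 'I_a -> 'I_n}) (g : {ffun 'I_b -> 'I_n}) j :
  fcat f g (rshift a j) = g j.
Proof. by rewrite ffunE -[rshift a j]/(unsplit (inr _ j)) unsplitK. Qed.

Lemma increasing_fcat n a b (f : {ffun 'I_a -> 'I_n}) (g : {ffun 'I_b -> 'I_n}) :
  increasing f -> increasing g -> (forall i j, f i < g j) -> increasing (fcat f g).
Proof.
move=> /increasingP fi /increasingP gi fg; apply/increasingP=> u v.
case: (split_ordP u) => i ->; case: (split_ordP v) => j ->; rewrite ?fcatl ?fcatr //=.
- exact: fi.
- by have := ltn_ord j; lia.
by rewrite ltn_add2l; apply: gi.
Qed.

Lemma fcat_all n a b (f : {ffun 'I_a -> 'I_n}) (g : {ffun 'I_b -> 'I_n}) (P : pred 'I_n) :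
  (forall i, P (f i)) -> (forall j, P (g j)) -> forall u, P (fcat f g u).
Proof.
by move=> Pf Pg u; case: (split_ordP u) => i ->; rewrite ?fcatl ?fcatr.
Qed.

(** * The two patterns *)

Section Pattern.
Variables (k m : nat) (o : bool) (chi : 'M[int]_m).

(** Both patterns at once: the central identity block has size [o], which is 0 or
    1. *)
Definition gen_pattern (a : 'M[int]_k) : 'M[int]_(k + (m + (o + (m + k)))) :=
  col_mx         (row_mx 0 (row_mx 0     (row_mx 0    (row_mx 0   a))))
  (col_mx        (row_mx 0 (row_mx 0     (row_mx 0    (row_mx chi 0))))
  (col_mx        (row_mx 0 (row_mx 0     (row_mx 1%:M (row_mx 0   0))))
  (col_mx        (row_mx 0 (row_mx chi^T (row_mx 0    (row_mx 0   0))))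
                 (row_mx a (row_mx 0     (row_mx 0    (row_mx 0   0)))))))%R.

Local Notation K := (k + (m + (o + (m + k)))).
Definition idx1 (s : 'I_k) : 'I_K := lshift _ s.
Definition idx2 (s : 'I_m) : 'I_K := rshift k (lshift _ s).
Definition idx3 (s : 'I_o) : 'I_K := rshift k (rshift m (lshift _ s)).
Definition idx4 (s : 'I_m) : 'I_K := rshift k (rshift m (rshift o (lshift k s))).
Definition idx5 (s : 'I_k) : 'I_K := rshift k (rshift m (rshift o (rshift m s))).

Variant idx_spec : 'I_K -> Type :=
| Idx1 s : idx_spec (idx1 s) | Idx2 s : idx_spec (idx2 s) | Idx3 s : idx_spec (idx3 s)
| Idx4 s : idx_spec (idx4 s) | Idx5 s : idx_spec (idx5 s).

Lemma idxP u : idx_spec u.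
Proof.
case: (split_ordP u) => [s ->|{}u ->]; first exact: Idx1.
case: (split_ordP u) => [s ->|{}u ->]; first exact: Idx2.
case: (split_ordP u) => [s ->|{}u ->]; first exact: Idx3.
case: (split_ordP u) => [s ->|s ->]; [exact: Idx4|exact: Idx5].
Qed.

Definition blockE := (col_mxEu, col_mxEd, row_mxEl, row_mxEr).

Lemma gen_pattern15 a s t : gen_pattern a (idx1 s) (idx5 t) = a s t.
Proof. by rewrite /gen_pattern !blockE. Qed.
Lemma gen_pattern24 a s t : gen_pattern a (idx2 s) (idx4 t) = chi s t.
Proof. by rewrite /gen_pattern !blockE. Qed.
Lemma gen_pattern33 a s t : gen_pattern a (idx3 s) (idx3 t) = 1%R.
Proof.
rewrite /gen_pattern !blockE mxE; case: o s t => -[[|s] // hs] [[|t] // ht].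
Qed.
Lemma gen_pattern42 a s t : gen_pattern a (idx4 s) (idx2 t) = chi t s.
Proof. by rewrite /gen_pattern !blockE mxE. Qed.
Lemma gen_pattern51 a s t : gen_pattern a (idx5 s) (idx1 t) = a s t.
Proof. by rewrite /gen_pattern !blockE. Qed.

(** The five blocks that carry the nonzero entries. *)
Variant nz_spec (a : 'M[int]_k) : 'I_K -> 'I_K -> int -> Type :=
| Nz15 s t : nz_spec a (idx1 s) (idx5 t) (a s t)
| Nz24 s t : nz_spec a (idx2 s) (idx4 t) (chi s t)
| Nz33 s t : nz_spec a (idx3 s) (idx3 t) 1%R
| Nz42 s t : nz_spec a (idx4 s) (idx2 t) (chi t s)
| Nz51 s t : nz_spec a (idx5 s) (idx1 t) (a s t).

Lemma gen_pattern_nz a u v : gen_pattern a u v != 0%R -> nz_spec a u v (gen_pattern a u v).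
Proof.
case: (idxP u) => s; case: (idxP v) => t; try by rewrite /gen_pattern !blockE mxE.
- by rewrite gen_pattern15 => _; constructor.
- by rewrite gen_pattern24 => _; constructor.
- by rewrite gen_pattern33 => _; constructor.
- by rewrite gen_pattern42 => _; constructor.
- by rewrite gen_pattern51 => _; constructor.
Qed.

Lemma gen_pattern_sym (a : 'M[int]_k) : (forall s t, a s t = a t s) ->
  forall u v, gen_pattern a u v = gen_pattern a v u.
Proof.
move=> sa u v; case: (idxP u) => s; case: (idxP v) => t; try by rewrite /gen_pattern !blockE !mxE.
- by rewrite gen_pattern15 gen_pattern51.
- by rewrite !gen_pattern33.
- by rewrite gen_pattern15 gen_pattern51.
Qed.
End Pattern.

Lemma even_patternE k m (a : 'M[int]_k) (chi : 'M[int]_m) : even_pattern a chi = gen_pattern false chi a.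
Proof.
rewrite /even_pattern /gen_pattern.
by rewrite !row_thin_mx col_flat_mx.
Qed.

Lemma odd_patternE k m (a : 'M[int]_k) (chi : 'M[int]_m) : odd_pattern a chi = gen_pattern true chi a.
Proof. by []. Qed.

(** * Reduction to a Ferrers board above the diagonal *)

Section Region.
Variables (k m : nat) (o : bool) (chi : B m) (n : nat).

Local Notation K := (k + (m + (o + (m + k)))).

(** Rows and columns of a copy of [chi], and the cell of the central 1 when [o]
    holds. *)
Definition witness : finType :=
  ({ffun 'I_m -> 'I_n} * {ffun 'I_m -> 'I_n} * ('I_n * 'I_n))%type.

(** The part of an occurrence that lies between the block [a] and the diagonal.
    The central 1 is only required to be weakly above the diagonal: an occurrence
    whose central 1 is off the diagonal needs different rows and columns in its
    centre, and is still completed by reflection. *)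
Definition is_core (p : 'M[int]_n) (h : witness) : bool :=
  let: (x, y, d) := h in
  [&& increasing x, increasing y, mxsub x y p == chi, [forall s, forall t, x s < y t] &
      o ==> [&& d.1 <= d.2, p d.1 d.2 == 1%R, [forall s, x s < d.1] & [forall s, d.2 < y s]]].

Definition inside (i j : 'I_n) (h : witness) : bool :=
  let: (x, y, d) := h in
  [&& i < j, [forall s, i < x s], [forall s, y s < j] & o ==> (i < d.1) && (d.2 < j)].

(** The coloured cells.  They form a Ferrers board by [region_le], strictly above
    the diagonal by [region_lt]. *)
Definition region (p : 'M[int]_n) (i j : 'I_n) : bool := [exists h, is_core p h && inside i j h].

Lemma inside_le (i j i' j' : 'I_n) h : inside i j h -> i' <= i -> j <= j' -> inside i' j' h.
Proof.
case: h => [[x y] d] /and4P[ij /forallP ix /forallP yj /implyP od] li lj; apply/and4P; split.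
- by lia.
- by apply/forallP=> s; apply: leq_ltn_trans li (ix s).
- by apply/forallP=> s; apply: leq_trans (yj s) lj.
apply/implyP=> /od/andP[h1 h2]; lia.
Qed.

Lemma region_le p (i j i' j' : 'I_n) : region p i j -> i' <= i -> j <= j' -> region p i' j'.
Proof.
case/existsP => h /andP[ch ih] li lj; apply/existsP; exists h; rewrite ch.
exact: inside_le ih li lj.
Qed.

Lemma region_lt p i j : region p i j -> i < j.
Proof. by case/existsP => -[[x y] d] /andP[_ /and4P[]]. Qed.

Variable p : B n.
Hypothesis pSI : p \in SI n.

(** In any occurrence, all the rows of the upper half precede all the columns of
    the right half and the central 1 is weakly above the diagonal, or this
    becomes true after exchanging rows and columns, which is possible since both
    [p] and the pattern are symmetric. *)
Lemma contains_region (a : 'M[int]_k) : (forall s t, a s t = a t s) ->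
  contains p (gen_pattern o chi a) ->
  exists r c : {ffun 'I_k -> 'I_n}, [/\ increasing r, increasing c, mxsub r c p = a &
     forall s t, region p (r s) (c t)].
Proof.
move=> asym.
  case/existsP => f0 /existsP[g0 /and3P[if0 ig0 /eqP fg0]].
  pose C (f g : {ffun 'I_K -> 'I_n}) :=
    (forall u v : 'I_K, u < k + m -> k + m + o <= v -> f u < g v) /\
    (forall s s' : 'I_o, f (idx3 k m s) <= g (idx3 k m s')).
  have [f [g [incf incg fg [C1 C2]]]] : exists f g, [/\ increasing f, increasing g,
       mxsub f g p = gen_pattern o chi a & C f g].
    have fgT : mxsub g0 f0 p = gen_pattern o chi a.
      apply/matrixP=> u v; rewrite mxE (SI_entry_sym pSI) (gen_pattern_sym chi asym).
      by have /matrixP/(_ v u) := fg0; rewrite mxE.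
    have /increasingP fi := if0; have /increasingP gi := ig0.
    case: (boolP [forall u : 'I_K, forall v : 'I_K, (u < k + m) && (k + m + o <= v) ==> (f0 u < g0 v)]) => [H|nH].
      have {}H (u v : 'I_K) : u < k + m -> k + m + o <= v -> f0 u < g0 v.
        by move=> h1 h2; have /forallP/(_ u)/forallP/(_ v) := H; rewrite h1 h2.
      have s0P (s s' : 'I_o) : s = s' by apply/val_inj; case: (o) s s' => -[[|s] ?] [[|s'] ?].
      case: (boolP [exists s : 'I_o, g0 (idx3 k m s) < f0 (idx3 k m s)]) => [/existsP[s0 lt]|nlt]; last first.
        exists f0, g0; split=> //; split=> // s s'; rewrite leqNgt; apply: contra nlt => lt.
        by apply/existsP; exists s; rewrite {1}(s0P s s').
      exists g0, f0; split=> //; split=> [u v u1 v1|s s']; last first.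
        by rewrite (s0P s s0) (s0P s' s0) ltnW.
      have l1 : g0 u < g0 (idx3 k m s0) by apply: gi => /=; lia.
      have l2 : f0 (idx3 k m s0) < f0 v.
        by apply: fi => /=; have := ltn_ord s0; lia.
      exact: ltn_trans l1 (ltn_trans lt l2).
    (* a row of the upper half that is not before a column of the right half
       separates the left columns from the lower rows *)
    exists g0, f0; split=> //.
    move: nH; rewrite negb_forall => /existsP[u]; rewrite negb_forall => /existsP[v].
    rewrite negb_imply -leqNgt => /andP[/andP[uk kv] gf].
    have l1 (u1 : 'I_K) : u1 < k + m + o -> g0 u1 < g0 v by move=> h; apply: gi; lia.
    have l2 (v1 : 'I_K) : k + m <= v1 -> f0 u < f0 v1 by move=> h; apply: fi; lia.
    split=> [u1 v1 h1 h2|s s'].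
      apply: leq_trans (l1 u1 _) (leq_trans gf (ltnW (l2 v1 _))); lia.
    apply: ltnW (leq_trans (l1 _ _) (leq_trans gf (ltnW (l2 _ _)))) => /=; have := ltn_ord s; have := ltn_ord s'; lia.
  have /increasingP fi := incf; have /increasingP gi := incg.
  have E u v : p (f u) (g v) = gen_pattern o chi a u v by rewrite -fg mxE.
  exists [ffun s => f (idx1 m o s)], [ffun s => g (idx5 m o s)]; split.
  - by apply/increasingP=> s t st; rewrite !ffunE; apply: fi.
  - by apply/increasingP=> s t st; rewrite !ffunE; apply: gi => /=; lia.
  - by apply/matrixP=> s t; rewrite !mxE !ffunE E gen_pattern15.
  move=> s t; rewrite !ffunE; apply/existsP.
  pose d := if insub 0 is Some s0 then (f (@idx3 k m o s0), g (@idx3 k m o s0)) else (f (idx1 m o s), f (idx1 m o s)).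
  exists ([ffun s => f (idx2 k o s)], [ffun s => g (idx4 k o s)], d).
  apply/andP; split; last first.
    apply/and4P; split.
    + by apply: C1 => /=; have := ltn_ord s; lia.
    + by apply/forallP=> s'; rewrite ffunE; apply: fi => /=; have := ltn_ord s; lia.
    + by apply/forallP=> s'; rewrite ffunE; apply: gi => /=; have := ltn_ord s'; lia.
    apply/implyP=> ot; rewrite /d; case: insubP => [s0 _ _|/negP[]]; last by rewrite ot.
    by apply/andP; split; [apply: fi | apply: gi] => /=; have := ltn_ord s; have := ltn_ord s0; lia.
  apply/and5P; split.
  - by apply/increasingP=> s' t' st; rewrite !ffunE; apply: fi => /=; lia.
  - by apply/increasingP=> s' t' st; rewrite !ffunE; apply: gi => /=; lia.
  - by apply/eqP/matrixP=> s' t'; rewrite mxE !ffunE E gen_pattern24.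
  - apply/forallP=> s'; apply/forallP=> t'; rewrite !ffunE; apply: C1 => /=.
      by have := ltn_ord s'; lia.
    by lia.
  apply/implyP=> ot; rewrite /d; case: insubP => [s0 _ _|/negP[]]; last by rewrite ot.
  rewrite /= C2 E gen_pattern33 eqxx /=; apply/andP; split.
    by apply/forallP=> s'; rewrite ffunE; apply: fi => /=; have := ltn_ord s'; lia.
  by apply/forallP=> s'; rewrite ffunE; apply: gi => /=; have := ltn_ord s0; lia.
Qed.

(** The copy of [chi] below the last row and before the first column of the
    occurrence of [a] completes it, together with the mirror images of both. *)
Lemma region_contains (a : 'M[int]_k) (r c : {ffun 'I_k -> 'I_n}) : (forall s t, a s t = a t s) ->
  (forall s, exists t, a s t != 0%R) -> 0 < k -> increasing r -> increasing c -> mxsub r c p = a ->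
  (forall s t, region p (r s) (c t)) -> contains p (gen_pattern o chi a).
Proof.
move=> asym anz k0 ir ic /matrixP rc rg.
have k1 : k.-1 < k by lia.
have /existsP[[[x y] d] /andP[/and5P[ix iy /eqP/matrixP xy /forallP xly od] /and4P[rc0 /forallP rx /forallP yc od']]]
  := rg (Ordinal k1) (Ordinal k0).
have rle s : r s <= r (Ordinal k1).
  have /increasingP H := ir; case: (ltngtP s k.-1) => h; first by apply/ltnW/H.
    by have := ltn_ord s; lia.
  by have -> : s = Ordinal k1 by apply: val_inj.
have cle t : c (Ordinal k0) <= c t.
  have /increasingP H := ic; case: (posnP t) => h; last by apply/ltnW/H.
  by have -> : t = Ordinal k0 by apply: val_inj.
have {}rc0 s t : r s < c t by exact: leq_ltn_trans (rle s) (leq_trans rc0 (cle t)).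
have {}rx s t : r s < x t by exact: leq_ltn_trans (rle s) (rx t).
have {}yc s t : y s < c t by exact: leq_trans (yc s) (cle t).
have {}xly s t : x s < y t by have /forallP := xly s; apply.
have dP : o -> [/\ d.1 <= d.2, p d.1 d.2 = 1%R, forall s, x s < d.1 & forall s, d.2 < y s].
  by move/implyP: od => + ot => /(_ ot)/and4P[h1 /eqP h2 /forallP h3 /forallP h4].
have {}od' s t : o -> r s < d.1 /\ d.2 < c t.
  move/implyP: od' => + ot => /(_ ot)/andP[h1 h2]; split.
    exact: leq_ltn_trans (rle s) h1.
  exact: leq_trans h2 (cle t).
have on (s : 'I_o) : o by have := leq_ltn_trans (leq0n s) (ltn_ord s); rewrite lt0b.
(* rows and columns of the occurrence; they differ in the centre only *)
pose F e := fcat r (fcat x (fcat ([ffun=> e] : {ffun 'I_o -> 'I_n}) (fcat y c))).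
have F1 e s : F e (idx1 m o s) = r s by rewrite fcatl.
have F2 e s : F e (idx2 k o s) = x s by rewrite fcatr fcatl.
have F3 e s : F e (idx3 k m s) = e by rewrite !fcatr fcatl ffunE.
have F4 e s : F e (idx4 k o s) = y s by rewrite !fcatr fcatl.
have F5 e s : F e (idx5 m o s) = c s by rewrite !fcatr.
have incF (e : 'I_n) : (o -> [/\ forall s, r s < e, forall s, x s < e, forall s, e < y s & forall s, e < c s]) ->
    increasing (F e).
  move=> eP; apply: increasing_fcat => //; [apply: increasing_fcat => //; [apply: increasing_fcat|]|].
  - apply/increasingP=> s t; have := ltn_ord t; have := leq_b1 o; lia.
  - exact: increasing_fcat.
  - move=> s; have [h1 h2 h3 h4] := eP (on s); rewrite ffunE.
    by apply: (@fcat_all _ _ _ _ _ (fun z => _ < val z)).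
  - move=> s; apply: (@fcat_all _ _ _ _ _ (fun z => _ < val z)) => [t|].
      by rewrite ffunE; have [_ + _ _] := eP (on t).
    apply: (@fcat_all _ _ _ _ _ (fun z => _ < val z)) => t; first exact: xly.
    by apply: ltn_trans (xly s s) (yc _ _).
  move=> s; apply: (@fcat_all _ _ _ _ _ (fun z => _ < val z)) => [t|]; first exact: rx.
  apply: (@fcat_all _ _ _ _ _ (fun z => _ < val z)) => [t|].
    by rewrite ffunE; have [+ _ _ _] := eP (on t).
  apply: (@fcat_all _ _ _ _ _ (fun z => _ < val z)) => t; last exact: rc0.
  by apply: ltn_trans (rx s t) (xly _ _).
have iF1 : increasing (F d.1).
  apply: incF => ot; have [h1 _ h2 h3] := dP ot; split=> // s.
  - by have [] := od' s s ot.
  - exact: leq_ltn_trans h1 (h3 s).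
  by have [_] := od' s s ot; apply: leq_ltn_trans.
have iF2 : increasing (F d.2).
  apply: incF => ot; have [h1 _ h2 h3] := dP ot; split=> // s.
  - by have [h _] := od' s s ot; apply: leq_trans h h1.
  - exact: leq_trans (h2 s) h1.
  by have [_] := od' s s ot.
apply/existsP; exists (F d.1); apply/existsP; exists (F d.2).
rewrite iF1 iF2 /=; apply/eqP; apply: mxsub_eqP => // [u|u v nz].
  case: (idxP u) => s.
  - by have [t st] := anz s; exists (idx5 m o t); rewrite gen_pattern15.
  - by have [t st] := B_row chi s; exists (idx4 k o t); rewrite gen_pattern24.
  - by exists (idx3 k m s); rewrite gen_pattern33.
  - by have [t st] := B_col chi s; exists (idx2 k o t); rewrite gen_pattern42.
  by have [t st] := anz s; exists (idx1 m o t); rewrite gen_pattern51.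
case: (gen_pattern_nz nz) => s t; rewrite ?F1 ?F2 ?F3 ?F4 ?F5.
- by have := rc s t; rewrite mxE.
- by have := xy s t; rewrite mxE.
- by have [] := dP (on s).
- by have := xy t s; rewrite mxE (SI_entry_sym pSI).
by have := rc t s; rewrite mxE (SI_entry_sym pSI) asym.
Qed.
End Region.

(** * Rearranging the positive entries of the region *)

(** Sets that are equinumerous within each fibre of [key]; a representative of
    each fibre serves as its index, so that [K] may be infinite. *)
Lemma card_by_key (T : finType) (K : eqType) (key : T -> K) (S : {set T}) (P1 P2 : pred T) :
  (forall t, t \in S ->
     #|[set x in S | P1 x && (key x == key t)]| = #|[set x in S | P2 x && (key x == key t)]|) ->
  #|[set x in S | P1 x]| = #|[set x in S | P2 x]|.
Proof.
move=> H; pose rep x := odflt x [pick y in S | key y == key x].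
have repS x : x \in S -> rep x \in S /\ key (rep x) = key x.
  move=> xS; rewrite /rep; case: pickP => [y /andP[yS /eqP] //|/(_ x)].
  by rewrite xS eqxx.
have repE x y : x \in S -> key x = key y -> rep x = rep y.
  move=> xS e; rewrite /rep -e; case: pickP => // /(_ x).
  by rewrite xS eqxx.
have cls P : #|[set x in S | P x]| = \sum_(t in S | rep t == t) #|[set x in S | P x && (key x == key t)]|.
  rewrite -sum1_card (partition_big rep (fun t => (t \in S) && (rep t == t))) /=; last first.
    move=> x; rewrite inE => /andP[xS _]; have [rS rk] := repS x xS.
    by rewrite rS (repE _ x) ?eqxx.
  apply: eq_bigr => t /andP[tS /eqP rt]; rewrite -sum1_card; apply: eq_bigl => x.
  rewrite !inE -andbA; case xS : (x \in S) => //=; congr (_ && _).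
  have [rS rk] := repS x xS.
  by apply/eqP/eqP => [<-//|/(repE _ _ xS) ->].
by rewrite !cls; apply: eq_bigr => t /andP[/H].
Qed.

Section Count.
Variables (k m : nat) (o : bool) (chi : B m) (n : nat).
Hypothesis k0 : 0 < k.
Local Notation reg := (region o chi).

Definition plus_cells (p : 'M[int]_n) : {set 'I_n * 'I_n} :=
  [set c | reg p c.1 c.2 && (p c.1 c.2 == 1%R)].

(** [a] is the matrix of the involution [s], which is the identity for [alpha]
    and the reversal for [beta]; [es] matches it with the order [e] of rows in a
    chain whose columns increase. *)
Lemma contains_chain (p : B n) (a : 'M[int]_k) (e : rel nat) (s : 'I_k -> 'I_k) :
  p \in SI n -> involutive s -> (forall i j, a i j = (j == s i)%:R%R) ->
  (forall r : 'I_k -> 'I_n, (forall i j : 'I_k, i < j -> r i < r j) <->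
     (forall i j : 'I_k, i < j -> e (r (s i)) (r (s j)))) ->
  contains p (gen_pattern o chi a) = has_chain k (reg p) e (plus_cells p).
Proof.
move=> pSI sK aE es.
have asym i j : a i j = a j i by rewrite !aE eq_sym (can2_eq sK sK).
apply/idP/idP.
  case/(contains_region pSI asym) => r [c [ir ic /matrixP rc rg]].
  apply/existsP; exists [ffun i => r (s i)]; apply/existsP; exists c.
  apply/and4P; split=> //.
  - apply/forallP=> i; rewrite inE /= ffunE rg /=.
    by have := rc (s i) i; rewrite mxE aE sK eqxx => ->.
  - apply/forallP=> i; apply/forallP=> j; apply/implyP=> ij; rewrite !ffunE.
    by have /increasingP/es H := ir; apply: H.
  by apply/forallP=> i; apply/forallP=> j; rewrite ffunE.
case/existsP=> r /existsP[c /and4P[ic /forallP ru /forallP er /forallP rg]].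
pose r' := [ffun i => r (s i)].
have er' : increasing r'.
  apply/increasingP; apply/(es r') => i j ij; rewrite !ffunE !sK.
  by have /forallP/(_ j)/implyP := er i; apply.
apply: (region_contains pSI asym _ k0 er' ic).
- by move=> i; exists (s i); rewrite aE eqxx.
- apply: mxsub_eqP => // [i|i j].
    by exists (s i); rewrite aE eqxx.
  rewrite aE; case: (j =P s i) => [-> _|]; last by rewrite eqxx.
  rewrite ffunE.
  by have := ru (s i); rewrite inE /= => /andP[_ /eqP].
by move=> i j; rewrite ffunE; have /forallP := rg (s i); apply.
Qed.

Lemma contains_alpha (p : B n) : p \in SI n ->
  contains p (gen_pattern o chi (alpha k)) = has_chain k (reg p) ltn (plus_cells p).
Proof.
move=> pSI; apply: (@contains_chain _ _ _ id) => // i j.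
by rewrite mxE eq_sym.
Qed.

Lemma contains_beta (p : B n) : p \in SI n ->
  contains p (gen_pattern o chi (beta k)) = has_chain k (reg p) gtn (plus_cells p).
Proof.
move=> pSI; apply: (contains_chain pSI (@rev_ordK k)) => [i j|r]; first by rewrite mxE.
have rl (i j : 'I_k) : i < j -> rev_ord j < rev_ord i by move=> /=; have := ltn_ord j; lia.
split=> H i j ij; first exact/H/rl.
by have := H _ _ (rl _ _ ij); rewrite !rev_ordK.
Qed.

(** If a witness for (i, j) uses a coloured entry, then the witness for the cell of
    that entry is one for (i, j) that ends in an earlier column.  So by induction
    on [j] some witness uses uncoloured entries only, and it survives any change
    of the coloured ones. *)
Lemma region_stable (p q : B n) :
  (forall i j : 'I_n, i <= j -> (i, j) \notin plus_cells p -> p i j != 0%R -> q i j = p i j) ->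
  forall i j, reg p i j -> reg q i j.
Proof.
move=> H i j; move: {2}(val j).+1 (ltnSn j) => b; elim: b j => // b IH j; rewrite ltnS => jb.
case/existsP => -[[x y] d] /andP[cr ins].
have /and4P[ij /forallP ix /forallP yj /implyP od] := ins.
have /and5P[incx incy /eqP/matrixP xy /forallP xly /implyP od2] := cr.
have sub (i' j' : 'I_n) : i < i' -> j' < j -> (i', j') \in plus_cells p -> reg q i j.
  move=> ii jj; rewrite inE /= => /andP[rg _].
  have rp : reg p i j' := region_le rg (ltnW ii) (leqnn _).
  exact: region_le (IH j' (leq_trans jj jb) rp) (leqnn _) (ltnW jj).
case: (boolP [exists s, exists t, (x s, y t) \in plus_cells p]) => [/existsP[s /existsP[t]]|nxy].
  exact: sub.
case: (boolP (o && (d \in plus_cells p))) => [/andP[ot]|nd].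
  by have /andP[h1 h2] := od ot; move: h1 h2; case: (d) => d1 d2; apply: sub.
apply/existsP; exists (x, y, d); rewrite ins andbT; apply/and5P; split=> //.
- apply/eqP; apply: mxsub_eqP => // [s|s t nz]; first exact: B_row.
  have e1 : p (x s) (y t) = chi s t by have := xy s t; rewrite mxE.
  rewrite -e1; apply: H; last by rewrite e1.
    by have /forallP/(_ t)/ltnW := xly s.
  by apply: contra nxy => h; apply/existsP; exists s; apply/existsP; exists t.
- exact/forallP.
apply/implyP=> ot; have /and4P[h1 /eqP h2 -> ->] := od2 ot; rewrite h1 !andbT /=.
rewrite H ?h2 //; move: nd; rewrite ot; case: (d) => //.
Qed.

Definition on_cells (U : {set 'I_n * 'I_n}) i j := ((i, j) \in U) || ((j, i) \in U).

(** The entries of [p] outside the coloured 1s and their mirror images. *)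
Definition erase_plus (p : 'M[int]_n) : 'M[int]_n :=
  \matrix_(i, j) (if on_cells (plus_cells p) i j then 0%R else p i j).

Definition graft (U : {set 'I_n * 'I_n}) (b : 'M[int]_n) : 'M[int]_n :=
  \matrix_(i, j) (if on_cells U i j then 1%R else b i j).

Definition row_set (U : {set 'I_n * 'I_n}) := [set x.1 | x in U].
Definition col_set (U : {set 'I_n * 'I_n}) := [set x.2 | x in U].

(** What rearranging the coloured 1s does not change. *)
Definition class_key (p : B n) :=
  ([set c | reg p c.1 c.2], erase_plus p, row_set (plus_cells p), col_set (plus_cells p)).

Lemma on_cellsC U i j : on_cells U i j = on_cells U j i.
Proof. by rewrite /on_cells orbC. Qed.

Lemma graft_erase (p : B n) : p \in SI n -> graft (plus_cells p) (erase_plus p) = p.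
Proof.
move=> pSI; apply/matrixP=> i j; rewrite !mxE; case: ifP => [|-> //].
by case/orP; rewrite inE => /andP[_ /eqP/= e]; rewrite -e // (SI_entry_sym pSI).
Qed.

Lemma plus_cells_filling (p : B n) : filling (reg p) (row_set (plus_cells p)) (col_set (plus_cells p)) (plus_cells p).
Proof.
apply/and5P; split=> //.
- by apply/forall_inP=> c; rewrite inE => /andP[].
- apply/dinjectiveP=> -[i j] [i' j']; rewrite !inE /= => /andP[_ /eqP e] /andP[_ /eqP e'] ii.
  by rewrite -ii in e' *; have -> // : j = j' by apply: (@B_row_inj _ p i); rewrite ?e ?e'.
apply/dinjectiveP=> -[i j] [i' j']; rewrite !inE /= => /andP[_ /eqP e] /andP[_ /eqP e'] jj.
by rewrite -jj in e' *; have -> // : i = i' by apply: (@B_col_inj _ p _ _ j); rewrite ?e ?e'.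
Qed.

(** Every filling [U] of the board of [p0], with the rows and columns of the
    coloured 1s of [p0], comes from an element of the class of [p0]. *)
Section Class.
Variable p0 : B n.
Hypothesis p0SI : p0 \in SI n.
Let R0 := row_set (plus_cells p0).
Let C0 := col_set (plus_cells p0).
Variable U : {set 'I_n * 'I_n}.
Hypothesis fU : filling (reg p0) R0 C0 U.
Let q := graft U (erase_plus p0).

Let U_reg i j : (i, j) \in U -> reg p0 i j.
Proof. by case/and5P: fU => /forall_inP H _ _ _ _ /H. Qed.

Let U_rows i : (i \in R0) <-> exists j, (i, j) \in U.
Proof.
case/and5P: fU => _ /eqP <- _ _ _; split=> [/imsetP[[i' j] /= ij ->]|[j ij]]; first by exists j.
by apply/imsetP; exists (i, j).
Qed.

Let U_cols j : (j \in C0) <-> exists i, (i, j) \in U.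
Proof.
case/and5P: fU => _ _ /eqP <- _ _; split=> [/imsetP[[i j'] /= ij ->]|[i ij]]; first by exists i.
by apply/imsetP; exists (i, j).
Qed.

Let U_fst i j j' : (i, j) \in U -> (i, j') \in U -> j = j'.
Proof. by case/and5P: fU => _ _ _ /dinjectiveP H _ h1 h2; have [] := H _ _ h1 h2 erefl. Qed.

Let U_snd i i' j : (i, j) \in U -> (i', j) \in U -> i = i'.
Proof. by case/and5P: fU => _ _ _ _ /dinjectiveP H h1 h2; have [] := H _ _ h1 h2 erefl. Qed.

Let R0P i : i \in R0 -> exists2 j : 'I_n, i < j & p0 i j = 1%R /\ (i, j) \in plus_cells p0.
Proof.
case/imsetP=> -[i' j]; rewrite inE /= => /andP[rg /eqP e] ->; exists j; first exact: region_lt rg.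
by rewrite inE /= rg e.
Qed.

Let C0P i : i \in C0 -> exists2 j : 'I_n, j < i & p0 i j = 1%R /\ (j, i) \in plus_cells p0.
Proof.
case/imsetP=> -[j i']; rewrite inE /= => /andP[rg /eqP e] ->; exists j; first exact: region_lt rg.
by rewrite inE /= rg e (SI_entry_sym p0SI).
Qed.

(* a row index of a coloured 1 is not a column index of another one: by symmetry
   line i of [p0] would have a nonzero entry on each side of the diagonal *)
Let RC i : i \in R0 -> i \in C0 -> False.
Proof.
case/R0P=> j ij [e _] /C0P[j' ji [e' _]].
have : j = j' by apply: (@B_row_inj _ p0 i); rewrite ?e ?e'.
by move=> ejj; move: ij; rewrite ejj ltnNge ltnW.
Qed.

Let erase_RC i j : (i \in R0) || (i \in C0) -> erase_plus p0 i j = 0%R.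
Proof.
move=> h; rewrite mxE; case: ifP => // /negP nU; apply/eqP/negPn/negP=> nz; apply: nU.
case/orP: h => [/R0P|/C0P] [j' _ [e inp]].
  have -> : j = j' by apply: (B_row_inj nz); rewrite e.
  by rewrite /on_cells inp.
have -> : j = j' by apply: (B_row_inj nz); rewrite e.
by rewrite /on_cells inp orbT.
Qed.

Let erase_nRC i j : i \notin R0 -> i \notin C0 -> erase_plus p0 i j = p0 i j.
Proof.
move=> iR iC; rewrite mxE; case: ifP => // /orP[] h.
  by case/negP: iR; apply/imsetP; exists (i, j).
by case/negP: iC; apply/imsetP; exists (j, i).
Qed.

Let on_U i j : on_cells U i j -> (i \in R0) || (i \in C0).
Proof.
case/orP=> h; apply/orP; [left|right]; [apply/U_rows|apply/U_cols]; by exists j.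
Qed.

(* each line of [q] has a single nonzero entry, in [U], in its mirror image, or
   outside both *)
Let q_row i : exists j, forall j', (q i j' != 0%R) = (j' == j).
Proof.
have inRC j : on_cells U i j -> (forall j', on_cells U i j' -> j' = j) ->
    forall j', (q i j' != 0%R) = (j' == j).
  move=> ij uni j'; rewrite mxE; case: ifP => [/uni ->|nj]; first by rewrite eqxx.
  by rewrite (erase_RC _ (on_U ij)) eqxx; case: eqP nj => // ->; rewrite ij.
case iR : (i \in R0).
  have [j ij] := iffLR (U_rows i) iR; exists j; apply: inRC => [|j' /orP[|h]].
  - by rewrite /on_cells ij.
  - by move/U_fst; apply.
  by case: (RC iR); apply/U_cols; exists j'.
case iC : (i \in C0).
  have [j ij] := iffLR (U_cols i) iC; exists j; apply: inRC => [|j' /orP[h|]].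
  - by rewrite /on_cells ij orbT.
  - by case: (@RC i) => //; apply/U_rows; exists j'.
  by move/U_snd; apply.
have [j nz] := B_row p0 i; exists j => j'; rewrite mxE.
case: ifP => [/on_U|_]; first by rewrite iR iC.
rewrite erase_nRC ?iR ?iC //; apply/idP/eqP => [nz'|->//].
exact: B_row_inj nz' nz.
Qed.

Let q_sym i j : q i j = q j i.
Proof. by rewrite !mxE on_cellsC [on_cells (plus_cells p0) i j]on_cellsC (SI_entry_sym p0SI). Qed.

Let q_signed : signed_perm_mx q.
Proof.
apply/and3P; split.
- apply/forallP=> i; apply/forallP=> j; rewrite !mxE; case: ifP => // _.
  by case: ifP => // _; rewrite !inE; apply: B_entry.
- apply/forallP=> i; apply/cards1P; have [j H] := q_row i; exists j.
  by apply/setP=> j'; rewrite !inE H.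
apply/forallP=> i; apply/cards1P; have [j H] := q_row i; exists j.
by apply/setP=> j'; rewrite !inE q_sym H.
Qed.

Let qB : B n := SignedPerm q_signed.

Let qB_SI : qB \in SI n.
Proof. by rewrite SI_sym; apply/eqP/matrixP=> i j; rewrite mxE /= q_sym. Qed.

Let U_lt (i j : 'I_n) : (i, j) \in U -> i < j.
Proof. by move/U_reg/region_lt. Qed.

Let q_off (i j : 'I_n) : i <= j -> (i, j) \notin U -> q i j = erase_plus p0 i j.
Proof.
move=> ij nU; rewrite mxE; case: ifP => // /orP[h|/U_lt]; first by rewrite h in nU.
by rewrite ltnNge ij.
Qed.

Let p0_off (i j : 'I_n) : i <= j -> (i, j) \notin plus_cells p0 -> erase_plus p0 i j = p0 i j.
Proof.
move=> ij nU; rewrite mxE; case: ifP => // /orP[h|]; first by rewrite h in nU.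
by rewrite inE /= => /andP[/region_lt]; rewrite ltnNge ij.
Qed.

(* [p0] and [q] have the same coloured cells: one inclusion gives that the cells
   of [U] are coloured for [q], which the other one uses *)
Let reg1 i j : reg p0 i j -> reg qB i j.
Proof.
apply: region_stable => {}i {}j ij np nz; rewrite -(p0_off ij np) in nz *.
apply: q_off => //; apply: contra nz => h; apply/eqP; apply: erase_RC; apply: (on_U (j := j)).
by rewrite /on_cells h.
Qed.

Let reg2 i j : reg qB i j -> reg p0 i j.
Proof.
apply: region_stable => {}i {}j ij np nz.
have nU : (i, j) \notin U.
  apply: contra np => h; rewrite inE /= reg1 ?U_reg //= mxE /on_cells h /=. by [].
rewrite /= (q_off ij nU) in nz *; move: nz; rewrite mxE; case: ifP => //; by rewrite eqxx.
Qed.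

Let regE i j : reg qB i j = reg p0 i j.
Proof. by apply/idP/idP => [/reg2|/reg1]. Qed.

Let plus_cells_qB : plus_cells qB = U.
Proof.
apply/setP=> -[i j]; rewrite inE regE /=; apply/andP/idP => [[rg /eqP e]|h]; last first.
  by rewrite U_reg // mxE /on_cells h.
apply/negPn/negP=> nU; have ij := ltnW (region_lt rg); rewrite (q_off ij nU) in e.
have : (i, j) \notin plus_cells p0.
  by apply: contraPN e => h; rewrite mxE /on_cells h.
move=> h; rewrite (p0_off ij h) in e; by rewrite inE /= rg e in h.
Qed.

Let erase_qB : erase_plus qB = erase_plus p0.
Proof.
apply/matrixP=> i j; rewrite mxE plus_cells_qB /=; case: ifP => [/on_U/erase_RC -> //|].
by rewrite mxE => ->.
Qed.

Lemma graft_class : exists2 p : B n, p \in SI n & class_key p = class_key p0 /\ plus_cells p = U.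
Proof.
exists qB => //; split; last exact: plus_cells_qB.
rewrite /class_key erase_qB plus_cells_qB; case/and5P: fU => _ /eqP er /eqP ec _ _.
rewrite /row_set /col_set er ec; congr (_, _, _, _).
by apply/setP=> c; rewrite !inE regE.
Qed.
End Class.

(** The class of [p0] is in bijection with the fillings of its board, and
    containment is read off the filling. *)
Lemma card_class (p0 : B n) (a : 'M[int]_k) (e : rel nat) : p0 \in SI n ->
  (forall p : B n, p \in SI n -> contains p (gen_pattern o chi a) = has_chain k (reg p) e (plus_cells p)) ->
  #|[set p in SI n | ~~ contains p (gen_pattern o chi a) && (class_key p == class_key p0)]| =
  #|[set U | filling (reg p0) (row_set (plus_cells p0)) (col_set (plus_cells p0)) U & ~~ has_chain k (reg p0) e U]|.
Proof.
move=> p0SI H.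
have regK (p : B n) : class_key p = class_key p0 -> reg p =2 reg p0.
  by case=> /setP e1 _ _ _ i j; have := e1 (i, j); rewrite !inE.
have chK (A A' : rel 'I_n) U : A =2 A' -> has_chain k A e U = has_chain k A' e U.
  move=> eA; rewrite /has_chain; apply: eq_existsb => r; apply: eq_existsb => c.
  by do 3![congr (_ && _)]; apply: eq_forallb => i; apply: eq_forallb => j.
have flK (A A' : rel 'I_n) R C U : A =2 A' -> filling A R C U = filling A' R C U.
  by move=> eA; rewrite /filling; congr (_ && _); apply: eq_forallb => x; rewrite eA.
rewrite -(@card_in_imset _ _ (fun p : B n => plus_cells p)); last first.
  move=> p p'; rewrite inE => /and3P[pS _ /eqP kp].
  rewrite inE => /and3P[p'S _ /eqP kp'] epl.
  apply/val_inj => /=; rewrite -(graft_erase pS) -(graft_erase p'S) epl; congr graft.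
  by move: kp'; rewrite -kp => -[_ -> _ _].
apply: eq_card => U; rewrite [RHS]inE; apply/imsetP/andP => [[p + ->]|[fU nc]].
  rewrite inE => /and3P[pS nc /eqP kp]; split.
    by have := plus_cells_filling p; rewrite (flK _ _ _ _ _ (regK p kp)); case: kp => _ _ -> ->.
  by rewrite -(chK _ _ _ (regK p kp)) -H.
have [p pS [kp pU]] := graft_class p0SI fU.
exists p; last by rewrite pU.
rewrite inE pS kp eqxx andbT (H p pS) pU.
by rewrite (chK _ _ _ (regK p kp)).
Qed.

Theorem card_avoid_alpha_beta :
  #|SI_avoid n (gen_pattern o chi (alpha k))| = #|SI_avoid n (gen_pattern o chi (beta k))|.
Proof.
have rle (p : B n) := @region_le m o chi n p.
apply: (@card_by_key _ _ class_key) => p0 p0S.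
apply: etrans (card_class p0S contains_alpha) _.
apply: etrans _ (esym (card_class p0S contains_beta)).
exact: card_fillings_ltn_gtn (rle p0) _ _ k0.
Qed.
End Count.

Lemma SI_avoid_even k m (chi : B m) (a : 'M[int]_k) n :
  SI_avoid n (even_pattern a chi) = SI_avoid n (gen_pattern false chi a).
Proof. by rewrite even_patternE. Qed.

Lemma SI_avoid_odd k m (chi : B m) (a : 'M[int]_k) n :
  SI_avoid n (odd_pattern a chi) = SI_avoid n (gen_pattern true chi a).
Proof. by rewrite odd_patternE. Qed.

Theorem corollary2p4 (k m : nat) (chi : B m) :
  I_Wilf (even_pattern (alpha k) chi) (even_pattern (beta k) chi) /\
  I_Wilf (odd_pattern (alpha k) chi) (odd_pattern (beta k) chi).
Proof.
case: k => [|k].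
  have -> : alpha 0 = beta 0 by apply/matrixP=> -[].
  by split.
split=> n _.
  have e a := SI_avoid_even chi (a : 'M[int]_k.+1) n.
  by rewrite (e (alpha k.+1)) (e (beta k.+1)); apply: card_avoid_alpha_beta.
have e a := SI_avoid_odd chi (a : 'M[int]_k.+1) n.
by rewrite (e (alpha k.+1)) (e (beta k.+1)); apply: card_avoid_alpha_beta.
Qed.
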